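(* Let $\mathcal A=\mathbb C\delta_0+\mathcal D'_+(\mathbb R)$. The unique linear functional $\Lambda:\mathcal A\to\mathbb C$ that does not vanish on any unit of $\mathcal A$ and satisfies $\Lambda(\delta_0)=1$ is the functional induced by the canonical homomorphism $\mathcal A\to\mathcal A/\mathcal D'_+(\mathbb R)=\mathbb C$, i.e. $c\,\delta_0+t\mapsto c$ for $c\in\mathbb C$, $t\in\mathcal D'_+(\mathbb R)$. Hence the algebra $\mathbb C\delta_0+\mathcal D'_+(\mathbb R)$ is a GKŻ algebra over $\mathbb C$.
   Context: $\mathcal D'(\mathbb R)$ is the space of distributions on $\mathbb R$. $\mathcal D'_+(\mathbb R)$ is the set of all $t\in\mathcal D'(\mathbb R)$ whose (closed) support is contained in the open half line $(0,\infty)$; it is a non-unital algebra with convolution as multiplication. $\delta_0$ is the Dirac distribution at $0$. $\mathcal A=\mathbb C\delta_0+\mathcal D'_+(\mathbb R)$ is a unital algebra under convolution with unity $\delta_0$, isomorphic to the unitisation of $\mathcal D'_+(\mathbb R)$. A unital algebra $A$ over a field $\mathbb F$ is a GKŻ algebra if every linear functional $\Lambda:A\to\mathbb F$ such that $\Lambda(u)\neq0$ for all units $u$ of $A$ and $\Lambda(\mathbf 1_A)=1$ is multiplicative. *)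

(* Defs.v *)
From HB Require Import structures.
From mathcomp Require Import all_boot all_order all_algebra.
From mathcomp Require Import complex.
From mathcomp Require Import mathcomp_extra boolp classical_sets functions.
From mathcomp Require Import cardinality set_interval interval_inference reals.
From mathcomp Require Import topology normedtype sequences derive realfun.

Set Implicit Arguments.
Unset Strict Implicit.
Unset Printing Implicit Defensive.

Import Order.TTheory GRing.Theory Num.Theory.
Import numFieldNormedType.Exports.
Import ComplexField.Normc.

Local Open Scope classical_set_scope.
Local Open Scope ring_scope.
Local Open Scope complex_scope.

Definition is_unit (A : pzRingType) (u : A) : Prop :=
  exists v : A, u * v = 1 /\ v * u = 1.

Definition normalized_nonvanishing_on_units (F : fieldType) (A : algType F)
    (L : {scalar A}) : Prop :=
  (forall u : A, is_unit u -> L u != 0) /\ L 1 = 1.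

(* Gleason-Kahane-Zelazko property. *)
Definition GKZ_algebra (F : fieldType) (A : algType F) : Prop :=
  forall L : {scalar A}, normalized_nonvanishing_on_units L ->
    forall a b : A, L (a * b) = L a * L b.

Section TestFunctions.
Variable R : realType.
Implicit Types (f : R -> R) (phi : R -> R[i]^o) (x h : R) (n : nat).

Definition smooth f : Prop := forall n x, derivable (derive1n n f) x 1.

Definition function_support phi : set R := closure [set x | phi x != 0].

(* C_c^infty(R; C): smoothness of a complex-valued function of a real variable
   is smoothness of its real and imaginary parts; likewise for [nderive]. *)
Definition test_function : pred (R -> R[i]^o) :=
  [pred phi | `[< [/\ smooth (fun x => complex.Re (phi x)),
                      smooth (fun x => complex.Im (phi x))
                    & compact (function_support phi)] >]].

Lemma smooth_linear (a b : R) (f g : R -> R) : smooth f -> smooth g ->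
  smooth (fun x => a * f x + b * g x).
Proof.
move=> sf sg n; suff [E d] : derive1n n (fun x => a * f x + b * g x) =
    (fun x => a * derive1n n f x + b * derive1n n g x) /\
    forall x, derivable (fun x => a * derive1n n f x + b * derive1n n g x) x 1.
  by rewrite E.
have d k x : derivable (fun x => a * derive1n k f x + b * derive1n k g x) x 1.
  by apply: derivableD; apply: derivableZ; [exact: sf|exact: sg].
split => //; elim: n => [//|n IH]; rewrite derive1nS IH; apply/funext => x.
rewrite !derive1nS !derive1E deriveD; first last.
- by apply: derivableZ; exact: sg.
- by apply: derivableZ; exact: sf.
by rewrite !deriveZ.
Qed.

Lemma test_function_submod_closed : submod_closed test_function.
Proof.
split.
  apply/asboolP; split => /=.
  - move=> n x; suff -> : derive1n n (fun _ : R => 0 : R) = cst 0 by exact: derivable_cst.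
    elim: n => // n IH; rewrite derive1nS IH; apply/funext => y.
    by rewrite derive1_cst.
  - move=> n x; suff -> : derive1n n (fun _ : R => 0 : R) = cst 0 by exact: derivable_cst.
    elim: n => // n IH; rewrite derive1nS IH; apply/funext => y.
    by rewrite derive1_cst.
  - rewrite /function_support (_ : [set x | _] = set0) ?closure0.
      exact: compact0.
    by rewrite -subset0 => x /=; rewrite eqxx.
move=> c u v /asboolP[uR uI uc] /asboolP[vR vI vc].
apply/asboolP; split => /=.
- have -> : (fun x => complex.Re ((c *: u + v) x)) = (fun x =>
      1 * (complex.Re c * complex.Re (u x) + (- complex.Im c) * complex.Im (u x))
      + 1 * complex.Re (v x)).
    apply/funext => x; rewrite !mul1r [(_ + _) x]/(c * u x + v x) raddfD /=.
    by case: c (u x) => [a b] [p q] /=; rewrite mulNr.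
  exact: (@smooth_linear 1 1 _ _ (@smooth_linear _ _ _ _ uR uI) vR).
- have -> : (fun x => complex.Im ((c *: u + v) x)) = (fun x =>
      1 * (complex.Re c * complex.Im (u x) + complex.Im c * complex.Re (u x))
      + 1 * complex.Im (v x)).
    apply/funext => x; rewrite !mul1r [(_ + _) x]/(c * u x + v x) raddfD /=.
    by case: c (u x) => [a b] [p q] /=.
  exact: (@smooth_linear 1 1 _ _ (@smooth_linear _ _ _ _ uI uR) vI).
- apply: (subclosed_compact _ (compactU uc vc)); first exact: closed_closure.
  rewrite -closureU; apply: closure_subset => x /= /eqP ne.
  apply: contrapT => /not_orP[/negP/negPn/eqP u0 /negP/negPn/eqP v0].
  by apply: ne; rewrite [LHS]/(c *: u x + v x) u0 v0 scaler0; exact: (addr0 (0 : R[i])).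
Qed.

HB.instance Definition _ :=
  GRing.isSubmodClosed.Build _ _ test_function test_function_submod_closed.

Record testfun := TestFun {
  testfun_val :> R -> R[i]^o;
  testfun_valP : testfun_val \in test_function }.

HB.instance Definition _ := [isSub for testfun_val].
HB.instance Definition _ := [Choice of testfun by <:].
HB.instance Definition _ := [SubChoice_isSubLmodule of testfun by <:].

Definition translate (phi : R -> R[i]^o) h : R -> R[i]^o :=
  fun x => phi (h + x).

Lemma derive1n_translate f h n :
  derive1n n (fun x => f (h + x)) = fun x => derive1n n f (h + x).
Proof.
elim: n => [//|n IH]; rewrite derive1nS IH; apply/funext => x.
rewrite derive1nS /derive1.
by under eq_fun do rewrite addrCA.
Qed.

Lemma smooth_translate f h : smooth f -> smooth (fun x => f (h + x)).
Proof.
move=> sf n x; rewrite derive1n_translate.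
have := sf n (h + x); rewrite /derivable.
suff -> : (fun t => t^-1 *: (derive1n n f (t *: 1 + (h + x)) - derive1n n f (h + x))) =
  (fun t => t^-1 *: (derive1n n f (h + (t *: 1 + x)) - derive1n n f (h + x))) by [].
by apply/funext => t; rewrite addrCA.
Qed.

Lemma translate_subproof (phi : testfun) h : translate phi h \in test_function.
Proof.
case: phi => phi /= /asboolP[pR pI pc]; apply/asboolP; split.
- exact: (@smooth_translate (fun x => complex.Re (phi x)) h pR).
- exact: (@smooth_translate (fun x => complex.Im (phi x)) h pI).
have cont : continuous (fun x : R => - h + x).
  by move=> x; apply: cvgD; [exact: cvg_cst|exact: cvg_id].
have c2 : compact [set - h + x | x in function_support phi].
  by apply: continuous_compact => //; exact: continuous_subspaceT.
apply: (subclosed_compact _ c2); first exact: closed_closure.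
have cl : closed [set - h + x | x in function_support phi].
  by apply: compact_closed c2; exact: Rhausdorff.
rewrite /function_support [X in _ `<=` X](closure_id _).1 //.
apply: closure_subset => x /= nz; exists (h + x); last by rewrite addKr.
exact: subset_closure.
Qed.

Definition ttranslate (phi : testfun) h : testfun :=
  TestFun (translate_subproof phi h).

Definition nderive n phi : R -> R[i] := fun x =>
  derive1n n (fun y => complex.Re (phi y)) x +i* derive1n n (fun y => complex.Im (phi y)) x.

(* sum_(k <= n) sup_x |phi^(k)(x)|; the suprema are finite for test functions. *)
Definition Cnorm n phi : R :=
  \sum_(k < n.+1) sup (range (fun x => normc (nderive k phi x))).

Lemma sup_range_ge0 (g : R -> R) : (forall x, 0 <= g x) -> 0 <= sup (range g).
Proof.
move=> g0; have [hs|nhs] := pselect (has_sup (range g)); last by rewrite sup_out.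
by apply: le_trans (g0 0) _; apply: sup_upper_bound => //; exists 0.
Qed.

Lemma normc_ge0 (z : R[i]) : 0 <= normc z.
Proof. by case: z => a b; exact: sqrtr_ge0. Qed.

Lemma Cnorm_ge0 n phi : 0 <= Cnorm n phi.
Proof. by apply: sumr_ge0 => k _; apply: sup_range_ge0 => x; exact: normc_ge0. Qed.

Lemma Cnorm_le n m phi : (n <= m)%N -> Cnorm n phi <= Cnorm m phi.
Proof.
move=> /subnK <-; elim: (m - n)%N => [//|k IH]; apply: le_trans IH _.
rewrite addSn /Cnorm [leRHS]big_ord_recr lerDl.
by apply: sup_range_ge0 => x; exact: normc_ge0.
Qed.

(* Continuity of a linear form on the LF-space of test functions, by the usual
   seminorm estimates on each compact set. *)
Definition seminorm_continuous (T : testfun -> R[i]^o) : Prop :=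
  forall K : set R, compact K -> exists (M : R) (n : nat),
    forall phi : testfun, function_support phi `<=` K ->
      normc (T phi) <= M * Cnorm n phi.

Definition distribution_pred : pred (testfun -> R[i]^o) :=
  [pred T | `[< linear T /\ seminorm_continuous T >]].

Lemma distribution_submod_closed : submod_closed distribution_pred.
Proof.
split.
  apply/asboolP; split => [c u v|K _]; first by rewrite scaler0 addr0.
  by exists 0, 0%N => phi _; rewrite mul0r [X in normc X](_ : _ = 0%C) ?normc0.
move=> c S T /asboolP[lS cS] /asboolP[lT cT]; apply/asboolP; split.
  move=> d u v; rewrite ![(c *: S + T) _]/(c *: S _ + T _) lS lT.
  by rewrite !scalerDr !scalerA mulrC addrACA.
move=> K cK; have [M [n hS]] := cS _ cK; have [N [m hT]] := cT _ cK.
exists (normc c * `|M| + `|N|), (maxn n m) => phi pK.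
rewrite [(c *: S + T) _]/(c * S phi + T phi).
apply: le_trans (le_normcD _ _) _; rewrite normcM mulrDl -mulrA.
apply: lerD.
  apply: ler_wpM2l; first exact: normc_ge0.
  apply: le_trans (hS _ pK) _; apply: le_trans (ler_wpM2r _ (ler_norm M)) _.
    exact: Cnorm_ge0.
  by apply: ler_wpM2l => //; apply: Cnorm_le; exact: leq_maxl.
apply: le_trans (hT _ pK) _; apply: le_trans (ler_wpM2r _ (ler_norm N)) _.
  exact: Cnorm_ge0.
by apply: ler_wpM2l => //; apply: Cnorm_le; exact: leq_maxr.
Qed.

HB.instance Definition _ := GRing.isSubmodClosed.Build _ _ distribution_pred
  distribution_submod_closed.

(* D'(R), as a C-vector space. *)
Record distr := Distr {
  distr_val :> testfun -> R[i]^o;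
  distr_valP : distr_val \in distribution_pred }.

HB.instance Definition _ := [isSub for distr_val].
HB.instance Definition _ := [Choice of distr by <:].
HB.instance Definition _ := [SubChoice_isSubLmodule of distr by <:].

Lemma smooth_bounded_on_compact f (K : set R) : smooth f -> compact K ->
  exists M, forall x, K x -> `|f x| <= M.
Proof.
move=> sf cK; have cf : continuous f.
  by move=> x; apply: differentiable_continuous; apply/derivable1_diffP; exact: (sf 0%N x).
have := compact_bounded (continuous_compact (continuous_subspaceT cf) cK).
case=> M [_ hM]; exists (M + 1) => x Kx.
by apply: (hM (M + 1)); [rewrite ltrDl|exists x].
Qed.

Lemma testfun_le_Cnorm0 (phi : testfun) x : normc (phi x) <= Cnorm 0 phi.
Proof.
case: phi => phi /= /asboolP[pR pI pc].
have [A hA] := smooth_bounded_on_compact pR pc.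
have [B hB] := smooth_bounded_on_compact pI pc.
have E y : nderive 0 phi y = phi y by rewrite /nderive /=; case: (phi y).
rewrite /Cnorm big_ord1; apply: ub_le_sup; last by exists x => //; rewrite E.
exists (Num.sqrt (A ^+ 2 + B ^+ 2)) => _ [y _ <-]; rewrite E.
have [->|nz] := eqVneq (phi y) 0.
  by have -> : normc (0 : R[i]^o) = 0; [exact: (@normc0 R)|exact: sqrtr_ge0].
have sy : function_support phi y by exact: subset_closure.
have := hA _ sy; have := hB _ sy; case: (phi y) => a b /= hb ha.
have A0 : 0 <= A := le_trans (normr_ge0 _) ha.
have B0 : 0 <= B := le_trans (normr_ge0 _) hb.
apply: ler_wsqrtr; rewrite -(real_normK (num_real a)) -(real_normK (num_real b)).
by apply: lerD; apply: lerXn2r; rewrite // nnegrE.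
Qed.

Definition dirac0_fun : testfun -> R[i]^o := fun phi : testfun => phi 0.

Lemma dirac0_subproof : dirac0_fun \in distribution_pred.
Proof.
apply/asboolP; split=> [//|K _]; exists 1, 0%N => phi _.
by rewrite mul1r; exact: testfun_le_Cnorm0.
Qed.

Definition dirac0 : distr := Distr dirac0_subproof.

Definition vanishes_on (T : distr) (U : set R) : Prop :=
  forall phi : testfun, function_support phi `<=` U -> T phi = 0.

(* The complement of the largest open set on which T vanishes. *)
Definition distr_support (T : distr) : set R :=
  ~` \bigcup_(U in [set U | open U /\ vanishes_on T U]) U.

Definition Dplus : set distr := [set T | distr_support T `<=` `]0, +oo[].

Definition calA : set distr :=
  [set u | exists (c : R[i]) (t : distr), Dplus t /\ u = c *: dirac0 + t].

(* W = S * T, that is <W, phi> = <S_x, <T_y, phi (x + y)>>.  The function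
   x |-> <T_y, phi (x + y)> is smooth but in general not compactly supported, so
   S is applied to a test function psi that agrees with it on a neighbourhood of
   the support of S.  Such a psi exists when the supports of S and T are bounded
   below, and <S, psi> does not depend on its choice. *)
Definition is_convolution (S T W : distr) : Prop :=
  forall phi : testfun, exists psi : testfun,
    (exists U : set R, [/\ open U, distr_support S `<=` U &
       forall x, U x -> psi x = T (ttranslate phi x)]) /\
    W phi = S psi.

End TestFunctions.

(* The set C delta_0 + D'_+(R) as a unital algebra: convolution is a partial
   operation on distributions, so the algebra is presented by an algType whose
   elements are identified by [to_distr] with those of [calA], the product being
   convolution and the unity delta_0.  Any two such presentations are isomorphic
   over [to_distr]. *)
Record calA_algebra (R : realType) := CalAAlgebra {
  calA_carrier :> algType R[i];
  to_distr : {linear calA_carrier -> distr R};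
  to_distr_inj : injective to_distr;
  range_to_distr : range to_distr = @calA R;
  to_distr1 : to_distr 1 = dirac0 R;
  to_distrM : forall a b : calA_carrier,
    is_convolution (to_distr a) (to_distr b) (to_distr (a * b)) }.

(* Main.v *)
(** If t is in D'_+ then its support lies in some [e, +oo[ with e > 0, so the n-th
    convolution power of t is supported in [n e, +oo[ and the Neumann series of
    delta_0 + t is locally finite: delta_0 + t is a unit.  A functional L that is
    nonzero on units and normalized must then vanish on D'_+, for otherwise
    L (delta_0 - t / L t) = 0 at the unit delta_0 - t / L t.  Hence L is the quotient
    map, which is multiplicative because D'_+ is an ideal.  That the convolution
    algebra exists at all rests on the smoothness of x |-> T (phi (x + .)) and on
    the fact that a distribution vanishes off its support. *)

Require Import Defs.
From HB Require Import structures.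
From mathcomp Require Import all_boot all_order all_algebra.
From mathcomp Require Import complex ring lra.
From mathcomp Require Import boolp classical_sets functions.
From mathcomp Require Import reals.
From mathcomp Require Import topology normedtype sequences derive realfun exp.

Set Implicit Arguments.
Unset Strict Implicit.
Unset Printing Implicit Defensive.

Import Order.TTheory GRing.Theory Num.Theory.
Import numFieldNormedType.Exports.
Import ComplexField.Normc.

Local Open Scope classical_set_scope.
Local Open Scope ring_scope.
Local Open Scope complex_scope.

(** * Smooth functions of a real variable *)

Section SmoothFunctions.
Variable R : realType.
Implicit Types f g h : R -> R.

(** [distr_support] is the complement of a union of open sets, and that [T] vanishes on this union
    takes a localization argument with smooth cutoffs. Once this is available, supports are traded
    for vanishing on half lines []-oo, s[], a condition stable under linear combinations and with
    [s] additive under convolution. This additivity is the one consequence of [to_distrM] that the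
    study of an arbitrary presentation [A] draws on: the ideal property and the vanishing of
    [x ^+ n] on ever larger half lines are both instances of it. Convergence of the Neumann series
    is purely local: all but finitely many terms vanish on a given test function, and an identity in
    [A] is checked on one test function at a time. To build a presentation, genuine test functions
    are required, whence a cutoff in [x]: for [T] in [calA] the function [x |-> T (phi (x + .))]
    vanishes far to the right but may have support unbounded to the left. *)

Lemma smooth_is_derive f : smooth f -> forall x, is_derive x (1 : R) f (derive1 f x).
Proof. by move=> sf x; rewrite derive1E; apply: derivableP; exact: (sf 0%N x). Qed.

Lemma smooth_derive1 f : smooth f -> smooth (derive1 f).
Proof. by move=> sf n x; have := sf n.+1 x; rewrite derive1Sn. Qed.

Lemma derive1n_smooth f n : smooth f -> smooth (derive1n n f).
Proof. by move=> sf; elim: n => [|n IH]; [exact: sf|apply: (smooth_derive1 IH)]. Qed.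

Lemma is_derive_derive1 f g : (forall x, is_derive x (1 : R) f (g x)) -> derive1 f = g.
Proof. by move=> fg; apply/funext => x; rewrite derive1E; case: (fg x). Qed.

(** Iterated derivatives are unfolded from the inside ([derive1Sn]), so the induction on the order
    passes from a member of [P] to its derivative, again a member. *)
Lemma smooth_coind (P : set (R -> R)) :
    (forall f, P f -> exists2 g, P g & forall x, is_derive x (1 : R) f (g x)) ->
  forall f, P f -> smooth f.
Proof.
move=> H f Pf n; elim: n f Pf => [|n IH] f Pf x; have [g Pg fg] := H _ Pf.
  exact: (@ex_derive _ _ _ _ _ _ _ (fg x)).
by rewrite derive1Sn (is_derive_derive1 fg); exact: IH.
Qed.

(* Closed under differentiation as soon as the generators are, which gives
   smoothness by coinduction, without iterated product or chain rules. *)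
Inductive smooth_closure (G : set (R -> R)) : (R -> R) -> Prop :=
| SCgen f : G f -> smooth_closure G f
| SCcst a : smooth_closure G (cst a)
| SCadd f g : smooth_closure G f -> smooth_closure G g ->
    smooth_closure G (fun x => f x + g x)
| SCmul f g : smooth_closure G f -> smooth_closure G g ->
    smooth_closure G (fun x => f x * g x)
| SCinv f : (forall x, f x != 0) -> smooth_closure G f ->
    smooth_closure G (fun x => (f x)^-1)
| SCcomp f g : smooth_closure G f -> smooth_closure G g ->
    smooth_closure G (fun x => f (g x)).

Lemma smooth_closure_smooth (G : set (R -> R)) :
    (forall f, G f -> exists2 g, smooth_closure G g &
       forall x, is_derive x (1 : R) f (g x)) ->
  forall f, smooth_closure G f -> smooth f.
Proof.
move=> H; apply: smooth_coind => f; elim.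
- by move=> g /H.
- move=> a; exists (cst 0) => [|x]; [exact: SCcst|exact: is_derive_cst].
- move=> {}f g Pf [f' Pf' df] Pg [g' Pg' dg].
  by exists (fun x => f' x + g' x) => [|x]; [exact: SCadd|exact: is_deriveD].
- move=> {}f g Pf [f' Pf' df] Pg [g' Pg' dg].
  exists (fun x => f x * g' x + g x * f' x) => [|x]; last exact: is_deriveM.
  by apply: SCadd; apply: SCmul.
- move=> {}f f0 Pf [f' Pf' df].
  (* Written without powers or opposites, so that it is visibly built from the constructors of
     [smooth_closure]. *)
  exists (fun x => (-1) * ((f x)^-1 * (f x)^-1) * f' x) => [|x]; last first.
    apply: (is_derive_eq (is_deriveV (f0 x) (df x))).
    by rewrite /GRing.scale /= mulN1r expr2 invfM.
  apply: SCmul Pf'; apply: SCmul; first exact: SCcst.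
  by apply: SCmul; exact: SCinv.
- move=> {}f g Pf [f' Pf' df] Pg [g' Pg' dg].
  exists (fun x => f' (g x) * g' x) => [|x]; last first.
    exact: (is_derive1_comp (df (g x)) (dg x)).
  by apply: SCmul Pg'; exact: SCcomp.
Qed.

(** Taking all smooth functions as generators yields every closure property below at once. *)
Lemma smooth_closure_id f : smooth_closure (@smooth R) f -> smooth f.
Proof.
apply: smooth_closure_smooth => g sg; exists (derive1 g).
  by apply: SCgen; exact: smooth_derive1.
exact: smooth_is_derive.
Qed.

Lemma smooth_cst (a : R) : smooth (fun _ : R => a).
Proof. by apply: smooth_closure_id; exact: SCcst. Qed.

Arguments smooth_cst : clear implicits.

Lemma smooth_id : smooth (fun x : R => x).
Proof.
move=> n x; case: n => [|n]; first exact: derivable_id.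
rewrite derive1Sn (_ : derive1 (fun x : R => x) = fun _ => 1); first exact: smooth_cst.
by apply: is_derive_derive1 => y; exact: is_derive_id.
Qed.

Lemma smooth_add f g : smooth f -> smooth g -> smooth (fun x => f x + g x).
Proof. by move=> sf sg; apply: smooth_closure_id; apply: SCadd; exact: SCgen. Qed.

Lemma smooth_mul f g : smooth f -> smooth g -> smooth (fun x => f x * g x).
Proof. by move=> sf sg; apply: smooth_closure_id; apply: SCmul; exact: SCgen. Qed.

Lemma smooth_inv f : (forall x, f x != 0) -> smooth f -> smooth (fun x => (f x)^-1).
Proof. by move=> f0 sf; apply: smooth_closure_id; apply: SCinv => //; exact: SCgen. Qed.

Lemma smooth_comp f g : smooth f -> smooth g -> smooth (fun x => f (g x)).
Proof. by move=> sf sg; apply: smooth_closure_id; apply: SCcomp; exact: SCgen. Qed.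

Lemma smooth_affine f (a b : R) : smooth f -> smooth (fun x => f (a * x + b)).
Proof.
move=> sf; apply: (@smooth_comp f (fun x => a * x + b) sf).
exact: (smooth_add (smooth_mul (smooth_cst _) smooth_id) (smooth_cst _)).
Qed.

(* x^-k exp(-1/x) extended by 0: the family indexed by k has derivatives in its
   own span. *)
Definition flat_fun (k : nat) (x : R) : R :=
  if 0 < x then x^-1 ^+ k * expR (- x^-1) else 0.

Lemma flat_fun_ge0 k (x : R) : 0 <= flat_fun k x.
Proof.
rewrite /flat_fun; case: ifP => // x0.
by rewrite mulr_ge0 ?expR_ge0// exprn_ge0// invr_ge0 ltW.
Qed.

(** With m = [n.+1], [expR y] is the m-th power of [expR (y / m)], which is at least [y / m]. *)
Lemma exprn_expRN_le n (y : R) : 0 <= y -> y ^+ n.+1 * expR (- y) <= n.+1%:R ^+ n.+1.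
Proof.
move=> y0; have n0 : n.+1%:R != 0 :> R by rewrite pnatr_eq0.
rewrite expRN ler_pdivrMr ?expR_gt0//.
have -> : expR y = expR (y / n.+1%:R) ^+ n.+1.
  by rewrite -expRM_natl -[_ *+ _]mulr_natl mulrCA divff ?mulr1.
rewrite -exprMn; apply: lerXn2r; rewrite ?nnegrE ?mulr_ge0 ?expR_ge0//.
rewrite mulrC -ler_pdivrMr ?ltr0n//.
by apply: le_trans (expR_ge1Dx _); rewrite lerDr.
Qed.

(** The quadratic bound forces the difference quotients at 0 to tend to 0. Dividing by [x ^+ 2]
    raises the exponent of [x^-1] from [k] to [k.+2]. *)
Lemma flat_fun_le k (x : R) : flat_fun k x <= k.+2%:R ^+ k.+2 * x ^+ 2.
Proof.
rewrite /flat_fun.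
case: ifP => [x0|_]; last by apply: mulr_ge0; [exact: exprn_ge0|exact: sqr_ge0].
have x2 : 0 < x ^+ 2 by rewrite exprn_gt0.
rewrite -ler_pdivrMr// mulrAC -exprVn -exprD addn2.
by apply: exprn_expRN_le; rewrite invr_ge0 ltW.
Qed.

Lemma is_derive_near f g (x d : R) :
  (\forall y \near x, f y = g y) -> is_derive x (1 : R) f d -> is_derive x (1 : R) g d.
Proof. by move=> fg; apply: near_eq_is_derive. Qed.

Lemma is_derive_flat_fun k (x : R) :
  is_derive x (1 : R) (flat_fun k) (- k%:R * flat_fun k.+1 x + flat_fun k.+2 x).
Proof.
have [x0|x0|->] := ltgtP x 0.
- rewrite /flat_fun ltNge (ltW x0) /= mulr0 addr0.
  apply: (@is_derive_near (cst 0)).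
  near=> y; rewrite /= ifF//; apply: le_gtF; near: y.
  exact: (lt_le_nbhsl x0).
- rewrite /flat_fun x0.
  have dV : is_derive x (1 : R) (fun y : R => y^-1) (- x ^- 2).
    have := is_deriveV (lt0r_neq0 x0) (is_derive_id x (1 : R)).
    by rewrite /GRing.scale /= mulr1.
  apply: (@is_derive_near (fun y => y^-1 ^+ k * expR (- y^-1))).
    near=> y; rewrite ifT//; near: y; exact: lt_nbhsr.
  have dE : is_derive x (1 : R) (fun y : R => expR (- y^-1)) (expR (- x^-1) * x ^- 2).
    have := @is_derive1_comp R expR (fun y => - y^-1) x _ _ (is_derive_expR _) (is_deriveN dV).
    by rewrite opprK.
  have dX := is_deriveX k dV; rewrite exprfctE in dX.
  apply: (is_derive_eq (is_deriveM dX dE)).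
  rewrite /GRing.scale /=; case: k {dX} => [|k]; rewrite !exprS ?expr0 /=;
    field; rewrite lt0r_neq0//.
- have f0 j : flat_fun j 0 = 0 by rewrite /flat_fun ltxx.
  rewrite !f0 mulr0 addr0; apply/is_derive1_caratheodory.
  (* The slope function of Caratheodory's criterion; its continuity at 0 follows by squeezing with
     [flat_fun_le]. *)
  exists (fun t => if t == 0 then 0 else flat_fun k t / t); split; last by rewrite eqxx.
    move=> t; rewrite f0 !subr0; case: eqVneq => [->|t0]; first by rewrite f0 mulr0.
    by rewrite divfK.
  have lim0 : k.+2%:R ^+ k.+2 * `|t| @[t --> (0 : R)] --> (0 : R).
    rewrite -[X in _ --> X](mulr0 (k.+2%:R ^+ k.+2)).
    apply: cvgM; first exact: cvg_cst.
    by rewrite -[X in _ --> X](@normr0 _ R); apply: cvg_norm; exact: cvg_id.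
  rewrite /prop_for /continuous_at. rewrite eqxx; apply: norm_cvg0.
  apply: (squeeze_cvgr _ (cvg_cst 0) lim0); near=> t; rewrite normr_ge0 /=.
  case: eqVneq => [->|t0]; first by rewrite normr0 mulr0.
  rewrite normrM normfV (ger0_norm (flat_fun_ge0 _ _)) ler_pdivrMr ?normr_gt0//.
  by rewrite -mulrA -expr2 real_normK ?num_real//; exact: flat_fun_le.
Unshelve. all: by end_near.
Qed.

Lemma smooth_flat_fun k : smooth (flat_fun k).
Proof.
apply: (@smooth_closure_smooth [set f | exists j, f = flat_fun j]); last first.
  by apply: SCgen; exists k.
move=> _ [j ->].
exists (fun x => - j%:R * flat_fun j.+1 x + flat_fun j.+2 x); last exact: is_derive_flat_fun.
apply: SCadd; last by apply: SCgen; exists j.+2.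
by apply: SCmul; [exact: SCcst|apply: SCgen; exists j.+1].
Qed.

Arguments smooth_flat_fun : clear implicits.

(** The classical transition from 0 to 1 across the unit interval; every cutoff below is made of
    affine reparametrizations of it. *)
Definition smooth_step (x : R) : R :=
  flat_fun 0 x / (flat_fun 0 x + flat_fun 0 (1 - x)).

Lemma flat_fun_gt0 k (x : R) : 0 < x -> 0 < flat_fun k x.
Proof.
by move=> x0; rewrite /flat_fun x0 mulr_gt0 ?expR_gt0// exprn_gt0// invr_gt0.
Qed.

Lemma smooth_step_denom_neq0 (x : R) : flat_fun 0 x + flat_fun 0 (1 - x) != 0.
Proof.
apply: lt0r_neq0; have [x0|x0] := ltP 0 x.
  by apply: ltr_wpDr; [exact: flat_fun_ge0|exact: flat_fun_gt0].
by apply: ltr_wpDl; [exact: flat_fun_ge0|apply: flat_fun_gt0; lra].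
Qed.

Lemma smooth_step_smooth : smooth smooth_step.
Proof.
have s0 := smooth_flat_fun 0.
have s1 : smooth (fun x => flat_fun 0 (1 - x)).
  have := @smooth_affine _ (-1) 1 s0.
  by congr smooth; apply/funext => x; congr flat_fun; ring.
exact: (smooth_mul s0 (smooth_inv smooth_step_denom_neq0 (smooth_add s0 s1))).
Qed.

Lemma smooth_step0 (x : R) : x <= 0 -> smooth_step x = 0.
Proof. by move=> x0; rewrite /smooth_step {1}/flat_fun ltNge x0 mul0r. Qed.

Lemma smooth_step1 (x : R) : 1 <= x -> smooth_step x = 1.
Proof.
move=> x1; rewrite /smooth_step [flat_fun 0 (1 - x)]/flat_fun ifF ?addr0 ?divff//.
  by apply: lt0r_neq0; apply: flat_fun_gt0; lra.
by apply: le_gtF; lra.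
Qed.

End SmoothFunctions.

(** * Bounds for derivatives of products and for difference quotients *)

Section DerivativeEstimates.
Variable R : realType.
Implicit Types f g : R -> R.

Lemma smooth_continuous f : smooth f -> continuous f.
Proof.
move=> sf x; apply: differentiable_continuous; apply/derivable1_diffP.
exact: (sf 0%N x).
Qed.

Lemma derive1n_linear n (a b : R) f g : smooth f -> smooth g ->
  derive1n n (fun x => a * f x + b * g x) =
  fun x => a * derive1n n f x + b * derive1n n g x.
Proof.
elim: n f g => [//|n IH] f g sf sg.
rewrite !derive1Sn -(IH _ _ (smooth_derive1 sf) (smooth_derive1 sg)).
congr derive1n; apply: is_derive_derive1 => x.
by apply: is_deriveD; apply: is_deriveZ; exact: smooth_is_derive.
Qed.

(** Each use of the product rule doubles the number of terms, which gives the factor [2 ^+ k]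
    without the Leibniz formula. *)
Lemma derive1n_mul_bound k f g (x A B : R) : smooth f -> smooth g ->
    (forall i, (i <= k)%N -> `|derive1n i f x| <= A) ->
    (forall i, (i <= k)%N -> `|derive1n i g x| <= B) ->
  `|derive1n k (fun y => f y * g y) x| <= 2 ^+ k * A * B.
Proof.
elim: k f g A B => [|k IH] f g A B sf sg fA gB.
  by rewrite /= expr0 mul1r normrM; apply: ler_pM => //; [exact: (fA 0%N)|exact: (gB 0%N)].
have sf' := smooth_derive1 sf; have sg' := smooth_derive1 sg.
have dfg : derive1 (fun y => f y * g y) =
    fun y => 1 * (f y * derive1 g y) + 1 * (g y * derive1 f y).
  apply: is_derive_derive1 => y; rewrite !mul1r.
  by apply: is_deriveM; exact: smooth_is_derive.
rewrite derive1Sn dfg derive1n_linear; [|exact: smooth_mul|exact: smooth_mul].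
rewrite !mul1r; apply: le_trans (ler_normD _ _) _.
have -> : 2 ^+ k.+1 * A * B = 2 ^+ k * A * B + 2 ^+ k * B * A by rewrite exprS; ring.
apply: lerD; apply: IH => // i ik.
- by apply: fA; exact: leqW.
- by rewrite -derive1Sn; exact: gB.
- by apply: gB; exact: leqW.
- by rewrite -derive1Sn; exact: fA.
Qed.

(** The intermediate point is recorded through its distance to [x], which treats both signs of [t]
    alike. *)
Lemma smooth_mean_value f (x t : R) : smooth f ->
  exists2 c, `|c - x| <= `|t| & f (t + x) - f x = derive1 f c * t.
Proof.
move=> sf; have d z (_ : z \in `]x, t + x[) := smooth_is_derive sf z.
have d' z (_ : z \in `]t + x, x[) := smooth_is_derive sf z.
have cf := continuous_subspaceT (smooth_continuous sf).
have [t0|/ltW t0] := leP 0 t.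
  have [|c + ->] := MVT_segment _ d (cf _); first lra.
  rewrite in_itv /= => /andP[c1 c2]; exists c; last by congr (_ * _); ring.
  by rewrite !ger0_norm; lra.
have [|c + E] := MVT_segment _ d' (cf _); first lra.
rewrite in_itv /= => /andP[c1 c2]; exists c.
  by rewrite !ler0_norm; lra.
by rewrite -[LHS]opprB E; ring.
Qed.

Definition diff_quot_err (t : R) f : R -> R :=
  fun x => t^-1 * (f (t + x) - f x) - derive1 f x.

Lemma diff_quot_err_smoothE t f : diff_quot_err t f =
  fun x => 1 * (t^-1 * f (t + x) + (- t^-1) * f x) + (-1) * derive1 f x.
Proof. by apply/funext => x; rewrite /diff_quot_err; ring. Qed.

(** Differentiation commutes with translation; bounds for all derivatives of the error thus reduce
    to a bound for the error itself. *)
Lemma derive1n_diff_quot_err k t f : smooth f ->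
  derive1n k (diff_quot_err t f) = diff_quot_err t (derive1n k f).
Proof.
move=> sf; rewrite !diff_quot_err_smoothE.
have st : smooth (fun x => f (t + x)) by exact: smooth_translate.
rewrite derive1n_linear; [|exact: smooth_linear|exact: smooth_derive1].
by rewrite derive1n_linear // derive1n_translate -derive1Sn.
Qed.

(** The mean value theorem is used twice: on [f] between [x] and [t + x], then on [derive1 f]
    between [x] and the point [c] so obtained. *)
Lemma diff_quot_err_le t f (M x : R) : smooth f -> t != 0 ->
  (forall y, `|derive1n 2 f y| <= M) -> `|diff_quot_err t f x| <= M * `|t|.
Proof.
move=> sf t0 f2; have M0 : 0 <= M := le_trans (normr_ge0 _) (f2 0).
have [c cx E] := smooth_mean_value x t sf.
have [e _ E'] := smooth_mean_value x (c - x) (smooth_derive1 sf).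
rewrite /diff_quot_err E mulrCA mulVf // mulr1.
rewrite -[X in derive1 f X](subrK x) E' normrM.
by apply: ler_pM => //; exact: f2.
Qed.

End DerivativeEstimates.

(** * Seminorms of test functions *)

Section TestFunctionTheory.
Variable R : realType.
Implicit Types (f g : R -> R) (F : R -> R[i]^o) (phi psi : testfun R) (x : R).

Local Notation Re := complex.Re.
Local Notation Im := complex.Im.

Lemma normc_le_ReIm (z : R[i]) : normc z <= `|Re z| + `|Im z|.
Proof.
case: z => a b /=; rewrite -(ger0_norm (addr_ge0 (normr_ge0 a) (normr_ge0 b))).
rewrite -sqrtr_sqr; apply: ler_wsqrtr.
rewrite sqrrD !real_normK ?num_real// -addrA lerD2l lerDr mulrn_wge0// mulr_ge0//.
Qed.

Lemma normc_ge_Re (z : R[i]) : `|Re z| <= normc z.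
Proof.
by case: z => a b /=; rewrite -sqrtr_sqr; apply: ler_wsqrtr; rewrite lerDl sqr_ge0.
Qed.

Lemma normc_ge_Im (z : R[i]) : `|Im z| <= normc z.
Proof.
by case: z => a b /=; rewrite -sqrtr_sqr; apply: ler_wsqrtr; rewrite lerDr sqr_ge0.
Qed.

Lemma Re_realM (a : R) (z : R[i]) : Re (a%:C * z) = a * Re z.
Proof. by case: z => u v /=; rewrite mul0r subr0. Qed.

Lemma Im_realM (a : R) (z : R[i]) : Im (a%:C * z) = a * Im z.
Proof. by case: z => u v /=; rewrite mul0r addr0. Qed.

Lemma function_support_sub F (C : set R) : closed C ->
  (forall x, F x != 0 -> C x) -> function_support F `<=` C.
Proof.
by move=> /closure_id CE FC; rewrite CE; apply: closureS.
Qed.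

Lemma function_supportN F x : ~ function_support F x -> F x = 0.
Proof. by move=> h; apply/eqP/negPn/negP => nz; apply: h; exact: subset_closure. Qed.

Lemma function_support_bound F (B : R) : (forall x, B < `|x| -> F x = 0) ->
  function_support F `<=` `[- B, B].
Proof.
move=> hB; apply: function_support_sub; first exact: interval_closed.
move=> x; apply: contraNP; rewrite /= in_itv /= -ler_norml => /negP.
by rewrite -ltNge => /hB ->.
Qed.

Lemma test_functionP F (B : R) : smooth (fun x => Re (F x)) ->
  smooth (fun x => Im (F x)) -> (forall x, B < `|x| -> F x = 0) -> F \in @test_function R.
Proof.
move=> sR sI hB; apply/asboolP; split=> //.
apply: (subclosed_compact _ (@segment_compact _ (- B) B)); first exact: closed_closure.
exact: function_support_bound.
Qed.

Lemma testfun_smooth_Re phi : smooth (fun x => Re (phi x)).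
Proof. by case: phi => F /= /asboolP[]. Qed.

Lemma testfun_smooth_Im phi : smooth (fun x => Im (phi x)).
Proof. by case: phi => F /= /asboolP[]. Qed.

Lemma testfun_compact phi : compact (function_support phi).
Proof. by case: phi => F /= /asboolP[]. Qed.

Lemma compact_bound (K : set R) : compact K ->
  exists2 B, 0 <= B & forall x, K x -> `|x| <= B.
Proof.
move=> /compact_bounded[M [_ hM]]; exists (`|M| + 1) => [|x Kx].
  by rewrite addr_ge0.
by apply: (hM (`|M| + 1)) => //; apply: le_lt_trans (ler_norm _) _; rewrite ltrDl.
Qed.

Lemma testfun_bound phi : exists2 B, 0 <= B & forall x, B < `|x| -> phi x = 0.
Proof.
have [B B0 hB] := compact_bound (@testfun_compact phi); exists B => // x Bx.
by apply: function_supportN => /hB; rewrite leNgt Bx.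
Qed.

Lemma testfun_eqP phi psi : phi =1 psi -> phi = psi.
Proof. by move=> E; apply: val_inj; apply/funext. Qed.

Lemma mulf_subproof f (sf : smooth f) phi :
  (fun x => (f x)%:C * phi x : R[i]^o) \in @test_function R.
Proof.
have [B _ hB] := testfun_bound phi; apply: (@test_functionP _ B).
- by under eq_fun do rewrite Re_realM; exact: (smooth_mul sf (@testfun_smooth_Re phi)).
- by under eq_fun do rewrite Im_realM; exact: (smooth_mul sf (@testfun_smooth_Im phi)).
- by move=> x /hB ->; exact: mulr0.
Qed.

Definition mulf f (sf : smooth f) phi : testfun R := TestFun (mulf_subproof sf phi).

Lemma near_derive1n0 k f x : (\forall y \near x, f y = 0) ->
  \forall y \near x, derive1n k f y = 0.
Proof.
(* Passing to the interior makes the derivative zero near each [y] close to [x], which is what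
   differentiating once more at [y] requires. *)
elim: k => [//|k IH] /IH f0; apply: filterS (nbhs_interior f0) => y fy.
rewrite derive1nS derive1E (@near_eq_derive _ _ _ _ (cst 0)).
  exact: derive_cst.
exact: fy.
Qed.

Lemma nderive_support k F x : ~ function_support F x -> nderive k F x = 0.
Proof.
move=> nx; have F0 : \forall y \near x, F y = 0.
  have oC := closed_openC (@closed_closure _ [set x | F x != 0]).
  apply: filterS (open_nbhs_nbhs (conj oC nx)).
  by move=> y; exact: function_supportN.
rewrite /nderive !(nbhs_singleton (near_derive1n0 _ _)) //.
  by apply: filterS F0 => y ->.
by apply: filterS F0 => y ->.
Qed.

Lemma nderive_subproof k phi : (nderive k phi : R -> R[i]^o) \in @test_function R.
Proof.
have [B _ hB] := compact_bound (@testfun_compact phi); apply: (@test_functionP _ B).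
- by apply: derive1n_smooth; exact: testfun_smooth_Re.
- by apply: derive1n_smooth; exact: testfun_smooth_Im.
- by move=> x Bx; apply: nderive_support => /hB; rewrite leNgt Bx.
Qed.

Definition tderive k phi : testfun R := TestFun (nderive_subproof k phi).

Lemma nderive_tderive j k phi x : nderive j (tderive k phi) x = nderive (j + k) phi x.
Proof. by rewrite /nderive /= /derive1n !iterD. Qed.

Lemma tderive_support k phi : function_support (tderive k phi) `<=` function_support phi.
Proof.
apply: function_support_sub; first exact: closed_closure.
by move=> x; apply: contraNP => /nderive_support /= ->.
Qed.

Lemma nderive_translate k F t x : nderive k (translate F t) x = nderive k F (t + x).
Proof.
rewrite /nderive /translate.
by rewrite (@derive1n_translate R (fun y => Re (F y)))
  (@derive1n_translate R (fun y => Im (F y))).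
Qed.

(** The order 0 estimate applies to [tderive k phi], itself a test function, so its supremum is a
    true upper bound; this supremum is one summand of [Cnorm n phi]. *)
Lemma normc_nderive_le_Cnorm phi k n x : (k <= n)%N -> normc (nderive k phi x) <= Cnorm n phi.
Proof.
move=> kn; have := testfun_le_Cnorm0 (tderive k phi) x.
rewrite /Cnorm big_ord1 /= => /le_trans; apply.
rewrite (bigD1 (Ordinal (kn : (k < n.+1)%N))) //= -[leLHS]addr0.
have E : (fun x0 => normc (nderive 0 (nderive k phi) x0)) =
    fun x0 => normc (nderive k phi x0).
  by apply/funext => y; rewrite (nderive_tderive 0 k).
rewrite E lerD2l; apply: sumr_ge0 => i _; apply: sup_range_ge0 => y; exact: sqrtr_ge0.
Qed.

(** [Cnorm n] is a sum of [n.+1] suprema; this is the origin of the factors [n.+1%:R] below. *)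
Lemma Cnorm_le_bound n F (B : R) :
  (forall k x, (k <= n)%N -> normc (nderive k F x) <= B) -> Cnorm n F <= n.+1%:R * B.
Proof.
move=> hB; have -> : n.+1%:R * B = \sum_(k < n.+1) B by rewrite sumr_const card_ord mulr_natl.
apply: ler_sum => i _; apply: ge_sup; first by exists (normc (nderive i F 0)); exists 0.
by move=> _ [x _ <-]; apply: hB; rewrite -ltnS.
Qed.

Lemma Cnorm_ttranslate n phi t : Cnorm n (ttranslate phi t) <= n.+1%:R * Cnorm n phi.
Proof.
by apply: Cnorm_le_bound => k x kn; rewrite nderive_translate normc_nderive_le_Cnorm.
Qed.

Lemma Cnorm_tderive n k phi : Cnorm n (tderive k phi) <= n.+1%:R * Cnorm (n + k) phi.
Proof.
apply: Cnorm_le_bound => j x jn; rewrite nderive_tderive.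
by apply: normc_nderive_le_Cnorm; rewrite leq_add2r.
Qed.

(** The error of the difference quotient, kept as a test function so that a distribution can be
    applied to it. *)
Definition diff_quot t phi : testfun R :=
  (t^-1)%:C *: (ttranslate phi t - phi) - tderive 1 phi.

Lemma ReB (z w : R[i]) : Re (z - w) = Re z - Re w. Proof. by rewrite raddfB. Qed.
Lemma ImB (z w : R[i]) : Im (z - w) = Im z - Im w. Proof. by rewrite raddfB. Qed.

Lemma diff_quotE t phi x : diff_quot t phi x =
  (t^-1)%:C * (phi (t + x) - phi x) - nderive 1 phi x.
Proof. by []. Qed.

Lemma Re_diff_quot t phi :
  (fun x => Re (diff_quot t phi x)) = diff_quot_err t (fun x => Re (phi x)).
Proof. by apply/funext => x; rewrite diff_quotE ReB Re_realM ReB. Qed.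

Lemma Im_diff_quot t phi :
  (fun x => Im (diff_quot t phi x)) = diff_quot_err t (fun x => Im (phi x)).
Proof. by apply/funext => x; rewrite diff_quotE ImB Im_realM ImB. Qed.

Lemma Cnorm_diff_quot n phi : exists M : R, forall t, t != 0 ->
  Cnorm n (diff_quot t phi) <= M * `|t|.
Proof.
(* Two orders are lost because the error at order [k] is bounded by the derivative of order [2 + k];
   the two summands serve the real and imaginary parts. *)
exists (n.+1%:R * (Cnorm n.+2 phi + Cnorm n.+2 phi)) => t t0; rewrite -mulrA.
have sR := @testfun_smooth_Re phi; have sI := @testfun_smooth_Im phi.
apply: Cnorm_le_bound => k x kn; apply: le_trans (normc_le_ReIm _) _.
rewrite /nderive Re_diff_quot Im_diff_quot /= !derive1n_diff_quot_err // mulrDl.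
have bnd y : normc (nderive (2 + k) phi y) <= Cnorm n.+2 phi.
  by apply: normc_nderive_le_Cnorm; rewrite -(addn2 n) addnC leq_add2r.
have sRk := derive1n_smooth (n := k) sR; have sIk := derive1n_smooth (n := k) sI.
apply: lerD; [apply: (diff_quot_err_le _ sRk t0)|apply: (diff_quot_err_le _ sIk t0)].
- move=> y; rewrite /derive1n -iterD; apply: le_trans (bnd y).
  exact: (normc_ge_Re (nderive (2 + k) phi y)).
- move=> y; rewrite /derive1n -iterD; apply: le_trans (bnd y).
  exact: (normc_ge_Im (nderive (2 + k) phi y)).
Qed.

(** For [t] in a bounded range the supports stay in one compact set, so a single continuity estimate
    of a distribution covers all of them. *)
Lemma diff_quot_support t phi (B : R) : function_support phi `<=` `[- B, B] ->
  `|t| <= 1 -> function_support (diff_quot t phi) `<=` `[- (B + 1), B + 1].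
Proof.
move=> hB t1; apply: function_support_bound; have h y : B < `|y| -> ~ function_support phi y.
  by move=> By /hB; rewrite /= in_itv /= -ler_norml leNgt By.
move=> x xB.
have Bx : B < `|x| by apply: lt_trans xB; rewrite ltrDl.
have Btx : B < `|t + x|.
  by have := ler_normB (t + x) t; rewrite [t + x]addrC addrK; lra.
rewrite diff_quotE (nderive_support _ (h _ Bx)).
by rewrite (function_supportN (h _ Bx)) (function_supportN (h _ Btx)) !subr0 mulr0.
Qed.

End TestFunctionTheory.

(** * Localization and supports *)

Section Localization.
Variable R : realType.
Implicit Types (T : distr R) (phi psi : testfun R) (x : R).

Lemma distr_linear_subproof T : linear T.
Proof. by case: T => T /= /asboolP[]. Qed.

HB.instance Definition _ T :=
  GRing.isLinear.Build R[i] (testfun R) (R[i]^o) _ (distr_val T) (distr_linear_subproof T).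

Lemma distrB T phi psi : T (phi - psi) = T phi - T psi.
Proof. exact: linearB. Qed.

Lemma distrZ T (c : R[i]) phi : T (c *: phi) = c * T phi.
Proof. by rewrite linearZ. Qed.

Lemma distrP T (c : R[i]) phi psi : T (c *: phi + psi) = c * T phi + T psi :> R[i].
Proof. exact: distr_linear_subproof. Qed.

Lemma distr_continuous T : seminorm_continuous T.
Proof. by case: T => T /= /asboolP[]. Qed.

Lemma distr_eqP (S T : distr R) : S =1 T -> S = T.
Proof. by move=> E; apply: val_inj; apply/funext. Qed.

(** A Lebesgue number for the cover of [K] by open sets on which [T] vanishes. The factor 3 leaves
    room for pieces of length [2 * d] in an open ball. *)
Lemma lebesgue_number_vanishing T (K : set R) : compact K ->
    K `<=` ~` distr_support T ->
  exists2 d : R, 0 < d & forall x, K x ->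
    exists2 U, vanishes_on T U & forall y, `|y - x| < 3 * d -> U y.
Proof.
move=> /compact_near_coveringP cK KT.
pose P (d x : R) := exists2 U, vanishes_on T U & forall y, `|y - x| < 3 * d -> U y.
have : \forall d \near 0^'+, K `<=` P d.
  apply: cK => x /KT; rewrite /distr_support setCK => -[U [oU vU] Ux].
  have /nbhs_ballP[e /= e0 xeU] : nbhs x U by apply: open_nbhs_nbhs.
  (* Half of [e] is spent on moving the centre, the other half on [3 * d]. *)
  exists (ball x (e / 2), [set d | d < e / 6]).
    split; first by apply: nbhsx_ballx; rewrite divr_gt0.
    by apply: nbhs_right_lt; rewrite divr_gt0.
  move=> [x' d] [/= xx' de]; exists U => // y yx'; apply: xeU.
  move: xx'; rewrite /ball /= => xx'.
  have := ler_distD x' x y; rewrite (distrC x' y); lra.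
move=> near_d; near (0 : R)^'+ => d; exists d => //.
by near: d.
Unshelve. all: by end_near.
Qed.

(* With d a Lebesgue number and s k a smooth step from 0 to 1 on
   [(k - N) d, (k - N + 1) d], T (s k * phi) does not depend on k since
   (s k - s k.+1) * phi lives on an interval of length 2 d; it is T phi for k = 0
   and 0 for k = 2 N. *)
Lemma distr_localization T phi :
  function_support phi `<=` ~` distr_support T -> T phi = 0.
Proof.
move=> KT; have cK := @testfun_compact R phi.
have [d d0 hd] := lebesgue_number_vanishing cK KT.
have [B B0 hB] := testfun_bound phi.
(* Hence [B + d <= N%:R * d]: on the support of [phi], step 0 has already reached 1 and step [N + N]
   is still 0. *)
have [N hN] : exists N : nat, B / d + 1 <= N%:R.
  exists (Num.truncn (B / d + 1)).+1; apply: ltW.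
  by apply: truncnS_gt.
pose s k x := smooth_step (d^-1 * x + (N%:R - k%:R)).
have ss k : smooth (s k) by apply: smooth_affine; exact: smooth_step_smooth.
have phi_out x : x < d - N%:R * d \/ N%:R * d < x -> phi x = 0.
  move=> h; apply: hB.
  have : B + d <= N%:R * d by rewrite -ler_pdivrMr // mulrDl divff ?lt0r_neq0.
  by move=> h1; rewrite ltr_normr; apply/orP; case: h => h; [right|left]; lra.
have dx x : x = d * (d^-1 * x) by rewrite mulVKf // lt0r_neq0.
have s0 k x : x <= (k%:R - N%:R) * d -> s k x = 0.
  by move=> h; apply: smooth_step0; rewrite -(ler_pM2l d0) mulrDr -dx mulr0; lra.
have s1 k x : (k%:R - N%:R) * d + d <= x -> s k x = 1.
  by move=> h; apply: smooth_step1; rewrite -(ler_pM2l d0) mulrDr -dx mulr1; lra.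
have psi0 : mulf (ss 0%N) phi = phi.
  apply: testfun_eqP => x /=; have [h|h] := ltP x (d - N%:R * d).
    by rewrite phi_out ?mulr0 //; left.
  by rewrite s1 ?mul1r //; lra.
have psiN : mulf (ss (N + N)%N) phi = 0.
  apply: testfun_eqP => x /=; have [h|h] := ltP (N%:R * d) x.
    by rewrite phi_out ?mulr0 //; right.
  by rewrite s0 ?mul0r // natrD addrK.
have step k : T (mulf (ss k) phi) = T (mulf (ss k.+1) phi).
  apply/eqP; rewrite -subr_eq0 -linearB; apply/eqP.
  set psi := _ - _; pose a := (k%:R - N%:R) * d.
  have psiE x : psi x = (s k x - s k.+1 x)%:C * phi x.
    by rewrite rmorphB mulrBl.
  have kS : k.+1%:R = k%:R + 1 :> R by rewrite -natr1.
  have psi_out x : x < a \/ a + 2 * d < x -> psi x = 0.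
    rewrite psiE /a => -[h|h]; [rewrite !s0|rewrite !s1]; rewrite ?subrr ?mul0r // ?kS; lra.
  (* The Lebesgue number concerns centres in the support of [phi]; on a window that misses this
     support [psi] is zero anyway. *)
  have [[x [Kx /andP[ax xa]]]|nx] :=
      pselect (exists x, function_support phi x /\ a <= x <= a + 2 * d).
    have [U vU xU] := hd _ Kx; apply: vU => y psiy; apply: xU.
    have : [set` `[a, a + 2 * d]] y.
      move: y psiy; apply: function_support_sub; first exact: interval_closed.
      move=> y; rewrite /= in_itv /=; apply: contraNT; rewrite negb_and -!ltNge => /orP h.
      by apply/eqP; exact: psi_out.
    by rewrite /= in_itv /= ltr_norml => /andP[] *; apply/andP; split; lra.
  rewrite (_ : psi = 0) ?linear0 //; apply: testfun_eqP => x.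
  have [/andP h|] := boolP (a <= x <= a + 2 * d); last first.
    by rewrite negb_and -!ltNge => /orP h; exact: psi_out.
  have -> : psi x = 0; last by [].
  rewrite psiE (_ : phi x = 0) ?mulr0 //; apply: function_supportN => Kx.
  by apply: nx; exists x; split => //; apply/andP.
have -> : T phi = T (mulf (ss (N + N)%N) phi).
  by rewrite -{1}psi0; elim: (N + N)%N => // k ->; exact: step.
by rewrite psiN linear0.
Qed.

(** Agreement on an open set keeps the closed support of the difference off the support of [T].
    Hence the choice of [psi] in [is_convolution] is immaterial. *)
Lemma distr_eq_near_support T phi psi (U : set R) : open U ->
  distr_support T `<=` U -> (forall x, U x -> phi x = psi x) -> T phi = T psi.
Proof.
move=> oU TU e; apply/eqP; rewrite -subr_eq0 -linearB; apply/eqP.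
apply: distr_localization; apply: (@subset_trans _ (~` U)); last exact: subsetC.
apply: function_support_sub; first exact: open_closedC.
by move=> x; apply: contraTnot => /e h; rewrite negbK; apply/eqP; rewrite -(subrr (psi x)) -{1}h.
Qed.

Lemma vanishes_on_subset T (U V : set R) : U `<=` V -> vanishes_on T V -> vanishes_on T U.
Proof. by move=> UV vV phi /subset_trans sU; apply: vV; exact: sU. Qed.

(** The margin between [r] and [s] absorbs the closure in the support of the difference. *)
Lemma vanishes_on_eq T (r s : R) phi psi : vanishes_on T `]-oo, s[ -> r < s ->
  (forall x, r < x -> phi x = psi x) -> T phi = T psi.
Proof.
move=> vT rs e; apply/eqP; rewrite -subr_eq0 -linearB; apply/eqP; apply: vT.
apply: (@subset_trans _ `]-oo, r]); last by move=> x; rewrite /= !in_itv /= => /le_lt_trans; apply.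
apply: function_support_sub; first exact: interval_closed.
move=> x; rewrite /= in_itv /=; apply: contraNT; rewrite -ltNge => /e h.
by apply/eqP; rewrite -(subrr (psi x)) -{1}h.
Qed.

Lemma vanishes_on0 T (r s : R) phi : vanishes_on T `]-oo, s[ -> r < s ->
  (forall x, r < x -> phi x = 0) -> T phi = 0.
Proof.
by move=> vT rs p0; rewrite (@vanishes_on_eq _ _ _ phi 0 vT rs p0) linear0.
Qed.

(** The bridge from supports to half lines; localization gives the implication towards vanishing. *)
Lemma distr_support_sub_itvP T (s : R) :
  distr_support T `<=` `[s, +oo[ <-> vanishes_on T `]-oo, s[.
Proof.
split=> [sT phi sphi|vT x]; last first.
  apply: contraPP => /=; rewrite in_itv /= andbT => /negP; rewrite -ltNge => xs.
  by apply; exists [set` `]-oo, s[]; [split => //; exact: interval_open|rewrite /= in_itv].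
apply: distr_localization; apply: (subset_trans sphi); apply: subsetCr => x /sT.
by rewrite /= !in_itv /= andbT leNgt => /negP.
Qed.

Lemma distr_support_closed T : closed (distr_support T).
Proof. by apply: open_closedC; apply: bigcup_open => U []. Qed.

(** The gap [e] comes from closedness: the support misses 0, hence a ball around 0. *)
Lemma DplusP T : Dplus T <-> exists2 e, 0 < e & vanishes_on T `]-oo, e[.
Proof.
split=> [DT|[e e0 /distr_support_sub_itvP vT] x /vT]; last first.
  by rewrite /= !in_itv /= !andbT; exact: lt_le_trans.
have T0 : nbhs (0 : R) (~` distr_support T).
  apply: open_nbhs_nbhs; split; first exact/closed_openC/distr_support_closed.
  by move=> /DT; rewrite /= in_itv /= ltxx.
have [e /= e0 he] := (nbhs_ballP _ _).1 T0; exists e => //.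
apply/distr_support_sub_itvP => x Tx.
have := DT _ Tx; rewrite /= !in_itv /= !andbT => x0; rewrite leNgt; apply/negP => xe.
by apply: (he x) => //; rewrite /ball /= sub0r normrN gtr0_norm.
Qed.

End Localization.

(** * Convolution of distributions *)

Section Convolution.
Variable R : realType.
Implicit Types (S T : distr R) (phi psi : testfun R) (x t : R).

Local Notation Re := complex.Re.
Local Notation Im := complex.Im.

Lemma is_derive_error_le (f : R -> R) x (d C : R) :
    (forall t, t != 0 -> `|t| <= 1 -> `|t^-1 * (f (t + x) - f x) - d| <= C * `|t|) ->
  is_derive x (1 : R) f d.
Proof.
move=> hC.
have lim0 : C * `|t| @[t --> (0 : R)^'] --> (0 : R).
  rewrite -[X in _ --> X](mulr0 C).
  apply: cvgM; first exact: cvg_cst.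
  rewrite -[X in _ --> X](@normr0 _ R); apply: cvg_norm.
  by apply: cvg_within_filter; exact: cvg_id.
have L : t^-1 *: ((f \o shift x) (t *: (1 : R)) - f x) @[t --> (0 : R)^'] --> d.
  apply/subr_cvg0; apply: norm_cvg0; apply: (squeeze_cvgr _ (cvg_cst 0) lim0).
  near=> t; rewrite normr_ge0 /= [t *: 1]mulr1; apply: hC.
    by near: t; exact: nbhs_dnbhs_neq.
  by near: t; apply: dnbhs0_le.
by apply: DeriveDef; [apply/cvg_ex; exists d|apply/cvg_lim].
Unshelve. all: by end_near.
Qed.

Definition regularize T phi : R -> R[i]^o := fun x => T (ttranslate phi x).

Lemma regularize_error_le T phi x : exists C : R, forall t, t != 0 -> `|t| <= 1 ->
  normc ((t^-1)%:C * (regularize T phi (t + x) - regularize T phi x)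
         - regularize T (tderive 1 phi) x) <= C * `|t|.
Proof.
set p := ttranslate phi x.
have [B B0 hB] := compact_bound (@testfun_compact R p).
have [M [n hM]] := distr_continuous T (@segment_compact _ (- (B + 1)) (B + 1)).
have [C hC] := Cnorm_diff_quot n p; exists (`|M| * C) => t t0 t1.
have -> : (t^-1)%:C * (regularize T phi (t + x) - regularize T phi x)
          - regularize T (tderive 1 phi) x = T (diff_quot t p).
  rewrite /diff_quot distrB distrZ distrB /regularize.
  congr (_ * (T _ - _) - T _); apply: testfun_eqP => y.
    by rewrite /= /translate addrCA addrA.
  exact: (esym (nderive_translate 1 phi x y)).
apply: le_trans (hM _ _) _.
  by apply: diff_quot_support => // y /hB; rewrite /= in_itv /= ler_norml.
apply: le_trans (ler_wpM2r (Cnorm_ge0 _ _) (ler_norm M)) _.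
by rewrite -mulrA ler_wpM2l // hC.
Qed.

Lemma is_derive_Re_regularize T phi x :
  is_derive x (1 : R) (fun y => Re (regularize T phi y)) (Re (regularize T (tderive 1 phi) x)).
Proof.
have [C hC] := regularize_error_le T phi x.
apply: (@is_derive_error_le _ _ _ C) => t t0 t1; apply: le_trans (hC t t0 t1).
by apply: le_trans (normc_ge_Re _); rewrite ReB Re_realM ReB.
Qed.

Lemma is_derive_Im_regularize T phi x :
  is_derive x (1 : R) (fun y => Im (regularize T phi y)) (Im (regularize T (tderive 1 phi) x)).
Proof.
have [C hC] := regularize_error_le T phi x.
apply: (@is_derive_error_le _ _ _ C) => t t0 t1; apply: le_trans (hC t t0 t1).
by apply: le_trans (normc_ge_Im _); rewrite ImB Im_realM ImB.
Qed.

(** The regularizations of all test functions by [T] form a class closed under differentiation. *)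
Lemma smooth_Re_regularize T phi : smooth (fun x => Re (regularize T phi x)).
Proof.
apply: (@smooth_coind R [set f | exists p, f = fun x => Re (regularize T p x)]).
  move=> _ [p ->]; exists (fun x => Re (regularize T (tderive 1 p) x)).
    by exists (tderive 1 p).
  exact: is_derive_Re_regularize.
by exists phi.
Qed.

Lemma smooth_Im_regularize T phi : smooth (fun x => Im (regularize T phi x)).
Proof.
apply: (@smooth_coind R [set f | exists p, f = fun x => Im (regularize T p x)]).
  move=> _ [p ->]; exists (fun x => Im (regularize T (tderive 1 p) x)).
    by exists (tderive 1 p).
  exact: is_derive_Im_regularize.
by exists phi.
Qed.

Lemma tderive0 phi : tderive 0 phi = phi.
Proof. by apply: testfun_eqP => x; rewrite /= /nderive /=; case: (phi x). Qed.

Lemma nderive_regularize T k phi :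
  nderive k (regularize T phi) = regularize T (tderive k phi).
Proof.
have tS j : tderive j.+1 phi = tderive 1 (tderive j phi).
  by apply: testfun_eqP => y; exact/esym/(nderive_tderive 1 j).
apply/funext => x; apply/eqP; rewrite eq_complex /nderive /=; apply/andP; split; apply/eqP.
  elim: k x => [|k IH] x; first by rewrite /= tderive0.
  rewrite derive1nS (funext IH) tS.
  by rewrite (is_derive_derive1 (is_derive_Re_regularize T (tderive k phi))).
elim: k x => [|k IH] x; first by rewrite /= tderive0.
rewrite derive1nS (funext IH) tS.
by rewrite (is_derive_derive1 (is_derive_Im_regularize T (tderive k phi))).
Qed.

(* Elements of calA are supported in [0, +oo[, so one fixed cutoff serves all
   convolutions. *)
Definition cutoff x : R := smooth_step (2 * x + 2).

Lemma smooth_cutoff : smooth cutoff.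
Proof. by apply: smooth_affine; exact: smooth_step_smooth. Qed.

Lemma cutoff0 x : x <= - 1 -> cutoff x = 0.
Proof. by move=> h; apply: smooth_step0; lra. Qed.

Lemma cutoff1 x : - (1 / 2) <= x -> cutoff x = 1.
Proof. by move=> h; apply: smooth_step1; lra. Qed.

Definition cut_regularize T phi : R -> R[i]^o :=
  fun x => (cutoff x)%:C * regularize T phi x.

(** Far to the right, [phi (x + .)] lives on the negative half line, where [T] vanishes; far to the
    left the cutoff is zero. *)
Lemma cut_regularize_out T phi (B x : R) : vanishes_on T `]-oo, 0[ -> 0 <= B ->
  function_support phi `<=` `[- B, B] -> B + 1 < `|x| -> cut_regularize T phi x = 0.
Proof.
move=> vT B0 hB; rewrite /cut_regularize ltr_normr => /orP[xB|xB]; last first.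
  by rewrite cutoff0 ?mul0r //; lra.
rewrite /regularize (vanishes_on0 vT (_ : B - x < 0)) ?mulr0 //; first lra.
move=> y yB; apply: (@function_supportN _ phi (x + y)) => /hB.
by rewrite /= in_itv /= => /andP[_]; lra.
Qed.

Lemma cut_regularize_subproof T (vT : vanishes_on T `]-oo, 0[) phi :
  cut_regularize T phi \in @test_function R.
Proof.
have [B B0 hB] := compact_bound (@testfun_compact R phi).
apply: (@test_functionP _ _ (B + 1)).
- under eq_fun do rewrite Re_realM; apply: smooth_mul smooth_cutoff _.
  exact: smooth_Re_regularize.
- under eq_fun do rewrite Im_realM; apply: smooth_mul smooth_cutoff _.
  exact: smooth_Im_regularize.
- move=> x xB; apply: (cut_regularize_out vT B0 _ xB) => y /hB.
  by rewrite /= in_itv /= ler_norml.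
Qed.

Definition tregularize T (vT : vanishes_on T `]-oo, 0[) phi : testfun R :=
  TestFun (cut_regularize_subproof vT phi).

Lemma derive1n_bounded (f : R -> R) (K : set R) n : smooth f -> compact K ->
  exists2 A, 0 <= A & forall i x, (i <= n)%N -> K x -> `|derive1n i f x| <= A.
Proof.
move=> sf cK; elim: n => [|n [A A0 hA]].
  have [A hA] := smooth_bounded_on_compact sf cK.
  by exists `|A| => // -[|//] x _ /hA /le_trans; apply; exact: ler_norm.
have [C hC] := smooth_bounded_on_compact (@derive1n_smooth _ _ n.+1 sf) cK.
exists (A + `|C|) => [|i x]; first by rewrite addr_ge0.
rewrite leq_eqVlt => /predU1P[->|ik] Kx.
  by apply: le_trans (hC _ Kx) _; apply: le_trans (ler_norm C) _; rewrite lerDr.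
by apply: le_trans (hA _ _ ik Kx) _; rewrite lerDl.
Qed.

Lemma regularize_bound T n (B : R) : exists M m, 0 <= M /\
  forall phi i x, function_support phi `<=` `[- B, B] -> (i <= n)%N -> `|x| <= B ->
    normc (regularize T (tderive i phi) x) <= M * Cnorm m phi.
Proof.
(* Translating by at most [B] moves a support from [[- B, B]] into this interval. The final order
   adds the [m] of this estimate to the [n] of the derivative. *)
have [M [m hM]] := distr_continuous T (@segment_compact _ (- (B + B)) (B + B)).
exists (`|M| * (m.+1%:R * m.+1%:R)), (m + n)%N; split; first by rewrite !mulr_ge0.
move=> phi i x hB ik xB; apply: le_trans (hM _ _) _.
  apply: function_support_bound => y yB.
  apply: (@function_supportN _ (tderive i phi) (x + y)) => /tderive_support/hB.
  rewrite /= in_itv /= -ler_norml; apply/negP; rewrite -ltNge.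
  by have := ler_normB (x + y) x; rewrite [x + y]addrC addrK; lra.
apply: le_trans (ler_wpM2r (Cnorm_ge0 _ _) (ler_norm M)) _.
rewrite -!mulrA ler_wpM2l //; apply: le_trans (Cnorm_ttranslate _ _ _) _.
rewrite ler_wpM2l //; apply: le_trans (Cnorm_tderive _ _ _) _.
by rewrite ler_wpM2l //; apply: Cnorm_le; rewrite leq_add2l.
Qed.

(** Continuity of [phi |-> tregularize vT phi] on each compact set; followed by the continuity of
    [S], it makes the convolution a distribution. *)
Lemma Cnorm_tregularize T (vT : vanishes_on T `]-oo, 0[) n (B : R) : 0 <= B ->
  exists M m, forall phi, function_support phi `<=` `[- B, B] ->
    Cnorm n (tregularize vT phi) <= M * Cnorm m phi.
Proof.
move=> B0.
have [A A0 hA] := derive1n_bounded n smooth_cutoff (@segment_compact _ (- (B + 1)) (B + 1)).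
have [M [m [M0 hM]]] := regularize_bound T n (B + 1).
(* [2 ^+ n] comes from the product rule, [A] bounds the cutoff, [M] the regularization; the two
   equal summands are for real and imaginary parts. *)
exists (n.+1%:R * (2 ^+ n * A * M + 2 ^+ n * A * M)), m => phi hB.
have hB1 : function_support phi `<=` `[- (B + 1), B + 1].
  by apply: (subset_trans hB) => x; rewrite /= !in_itv /= => /andP[] *; apply/andP; split; lra.
rewrite -[leRHS]mulrA; apply: Cnorm_le_bound => k x kn.
have [xB|xB] := leP `|x| (B + 1); last first.
  rewrite nderive_support.
    rewrite (_ : normc _ = 0); last exact: (@normc0 R).
    by rewrite !mulr_ge0 ?addr_ge0 ?mulr_ge0 ?Cnorm_ge0 ?exprn_ge0.
  have out y : B + 1 < `|y| -> cut_regularize T phi y = 0 by exact: cut_regularize_out.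
  by move=> /(function_support_bound out); rewrite /= in_itv /= -ler_norml leNgt xB.
have le2 : 2 ^+ k * A * (M * Cnorm m phi) <= 2 ^+ n * A * M * Cnorm m phi.
  rewrite -!mulrA ler_wpM2r ?mulr_ge0 ?Cnorm_ge0 //.
  by apply: ler_weXn2l => //; lra.
have hC i : (i <= k)%N -> `|derive1n i cutoff x| <= A.
  move=> ik; apply: hA; first exact: leq_trans ik kn.
  by rewrite /= in_itv /= -ler_norml.
have hF i : (i <= k)%N -> normc (nderive i (regularize T phi) x) <= M * Cnorm m phi.
  by move=> ik; rewrite nderive_regularize; apply: hM => //; exact: leq_trans ik kn.
apply: le_trans (normc_le_ReIm _) _; rewrite /nderive /= mulrDl.
apply: lerD; apply: le_trans le2.
  rewrite (_ : (fun y => Re _) = fun y => cutoff y * Re (regularize T phi y)); last first.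
    by apply/funext => y; rewrite Re_realM.
  apply: derive1n_mul_bound => //; [exact: smooth_cutoff|exact: smooth_Re_regularize|].
  by move=> i /hF; apply: le_trans; exact: (normc_ge_Re (nderive i _ x)).
rewrite (_ : (fun y => Im _) = fun y => cutoff y * Im (regularize T phi y)); last first.
  by apply/funext => y; rewrite Im_realM.
apply: derive1n_mul_bound => //; [exact: smooth_cutoff|exact: smooth_Im_regularize|].
by move=> i /hF; apply: le_trans; exact: (normc_ge_Im (nderive i _ x)).
Qed.

Lemma tregularize_linear T (vT : vanishes_on T `]-oo, 0[) (c : R[i]) phi psi :
  tregularize vT (c *: phi + psi) = c *: tregularize vT phi + tregularize vT psi.
Proof.
apply: testfun_eqP => x.
have E : ttranslate (c *: phi + psi) x = c *: ttranslate phi x + ttranslate psi x.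
  exact: testfun_eqP.
transitivity ((cutoff x)%:C * (c * T (ttranslate phi x) + T (ttranslate psi x)) : R[i]).
  by rewrite -distrP -E.
by rewrite mulrDr mulrCA.
Qed.

Lemma convolution_subproof S T (vT : vanishes_on T `]-oo, 0[) :
  (fun phi => S (tregularize vT phi) : R[i]^o) \in @distribution_pred R.
Proof.
apply/asboolP; split=> [c phi psi|K /compact_bound[B B0 hB]].
  by rewrite tregularize_linear linearP.
have [M [n hM]] := distr_continuous S (@segment_compact _ (- (B + 1)) (B + 1)).
have [C [m hC]] := Cnorm_tregularize vT n B0.
exists (`|M| * C), m => phi pK.
have pB : function_support phi `<=` `[- B, B].
  by move=> x /pK/hB; rewrite /= in_itv /= ler_norml.
apply: le_trans (hM _ _) _.
  by apply: function_support_bound => y; exact: cut_regularize_out.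
apply: le_trans (ler_wpM2r (Cnorm_ge0 _ _) (ler_norm M)) _.
by rewrite -mulrA ler_wpM2l // hC.
Qed.

Definition convolution S T (vT : vanishes_on T `]-oo, 0[) : distr R :=
  Distr (convolution_subproof S vT).

End Convolution.

(** * The unital algebra C delta_0 + D'_+ under convolution *)

Section ConvolutionAlgebra.
Variable R : realType.
Implicit Types (S T V W : distr R) (phi psi : testfun R) (x : R).

Lemma distr_addE S T phi : (S + T) phi = S phi + T phi. Proof. by []. Qed.
Lemma distr_scaleE (c : R[i]) T phi : (c *: T) phi = c * T phi. Proof. by []. Qed.

(** Supplies the slack in [vanishes_on_convolution], where functions must agree on an open set
    around a support. *)
Lemma compact_itv_lt (K : set R) (a : R) : compact K -> K `<=` `]-oo, a[ ->
  exists2 e, 0 < e & forall x, K x -> x <= a - e.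
Proof.
move=> /compact_near_coveringP cK Ka.
have near_e : \forall e \near (0 : R)^'+, K `<=` [set x | x <= a - e].
  apply: (cK R _ (fun e x => x <= a - e)) => x /Ka; rewrite /= in_itv /= => xa.
  exists (ball x ((a - x) / 2), [set e | e < (a - x) / 2]).
    split; first by apply: nbhsx_ballx; lra.
    by apply: nbhs_right_lt; lra.
  move=> [y e] [/=]; rewrite /ball /= ltr_norml => /andP[] *; lra.
near (0 : R)^'+ => e; exists e; first by near: e; exact: nbhs_right_gt.
by near: e.
Unshelve. all: by end_near.
Qed.

(** For [x] near the support of [S], [phi (x + .)] lives strictly to the left of [t], so [psi] is
    zero there. The argument uses the relation [is_convolution] alone and so applies to every
    presentation of the algebra. *)
Lemma vanishes_on_convolution S T W (s t : R) : is_convolution S T W ->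
  vanishes_on S `]-oo, s[ -> vanishes_on T `]-oo, t[ -> vanishes_on W `]-oo, s + t[.
Proof.
move=> cST vS vT phi sphi; have [psi [[U [oU SU psiU]] ->]] := cST phi.
have [e e0 he] := compact_itv_lt (@testfun_compact R phi) sphi.
rewrite -[RHS](linear0 (distr_val S : {linear testfun R -> R[i]^o})).
(* Half of the gap [e] makes room for an open neighbourhood of the support of [S], the rest keeps
   [s + t - e - x] below [t]. *)
apply: (@distr_eq_near_support _ _ _ _ (U `&` `]s - e / 2, +oo[)).
- by apply: openI => //; exact: interval_open.
- move=> x Sx; split; first exact: SU.
  have /distr_support_sub_itvP/(_ _ Sx) := vS.
  by rewrite /= !in_itv /= !andbT; lra.
- move=> x [Ux]; rewrite /= in_itv /= andbT => xs; rewrite psiU //.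
  apply: (vanishes_on0 vT (_ : s + t - e - x < t)); first lra.
  move=> y xy; apply: (@function_supportN _ phi (x + y)) => /he; lra.
Qed.

Lemma tregularizeE T (vT : vanishes_on T `]-oo, 0[) phi x : - (1 / 2) <= x ->
  tregularize vT phi x = T (ttranslate phi x).
Proof.
by move=> x2; rewrite /= /cut_regularize cutoff1 // [LHS]mul1r.
Qed.

Lemma convolutionP S T (vT : vanishes_on T `]-oo, 0[) : vanishes_on S `]-oo, 0[ ->
  is_convolution S T (convolution S vT).
Proof.
move=> vS phi; exists (tregularize vT phi); split => //.
exists [set` `]- (1 / 2), +oo[]; split; first exact: interval_open.
  move=> x Sx; have /distr_support_sub_itvP/(_ _ Sx) := vS.
  by rewrite /= !in_itv /= !andbT; lra.
move=> x; rewrite /= in_itv /= andbT => /ltW; exact: tregularizeE.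
Qed.

(* Both sides apply S, T and V in this order to (x, y, z) |-> phi (x + y + z); only
   the cutoffs differ, away from the supports. *)
Lemma convolutionA S T V (vT : vanishes_on T `]-oo, 0[) (vV : vanishes_on V `]-oo, 0[)
    (vTV : vanishes_on (convolution T vV) `]-oo, 0[) : vanishes_on S `]-oo, 0[ ->
  convolution S vTV = convolution (convolution S vT) vV.
Proof.
move=> vS; apply: distr_eqP => phi.
(* With [x] and [y] both above [- (1 / 4)], the sum stays above [- (1 / 2)], where the cutoff is
   1. *)
apply: (vanishes_on_eq vS (_ : - (1 / 4) < 0)); first lra.
move=> x x4; congr (_ * _).
apply: (vanishes_on_eq vT (_ : - (1 / 4) < 0)); first lra.
move=> y y4.
have cy : cutoff y = 1 by apply: cutoff1; lra.
have cxy : cutoff (x + y) = 1 by apply: cutoff1; lra.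
rewrite /= /translate /cut_regularize cy cxy.
by congr (_ * V _); apply: testfun_eqP => z; rewrite /= /translate addrA.
Qed.

Lemma convolution_dirac0l T (vT : vanishes_on T `]-oo, 0[) :
  convolution (dirac0 R) vT = T.
Proof.
apply: distr_eqP => phi.
rewrite [LHS](_ : _ = T (ttranslate phi 0)); last by apply: tregularizeE; lra.
by congr (T _); apply: testfun_eqP => x; rewrite /= /translate add0r.
Qed.

Lemma convolution_dirac0r S (v0 : vanishes_on (dirac0 R) `]-oo, 0[) :
  vanishes_on S `]-oo, 0[ -> convolution S v0 = S.
Proof.
move=> vS; apply: distr_eqP => phi.
apply: (vanishes_on_eq vS (_ : - (1 / 2) < 0)); first lra.
move=> x /ltW x2; rewrite tregularizeE // [LHS]/(phi (x + 0)) addr0 //.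
Qed.

Lemma convolution_linearl (c : R[i]) S T V (vV : vanishes_on V `]-oo, 0[) :
  convolution (c *: S + T) vV = c *: convolution S vV + convolution T vV.
Proof. exact: distr_eqP. Qed.

Lemma convolution_linearr (c : R[i]) S T V (vT : vanishes_on T `]-oo, 0[)
    (vV : vanishes_on V `]-oo, 0[) (vTV : vanishes_on (c *: T + V) `]-oo, 0[) :
  convolution S vTV = c *: convolution S vT + convolution S vV.
Proof.
apply: distr_eqP => phi.
transitivity (S (c *: tregularize vT phi + tregularize vV phi)); last exact: distrP.
congr (S _); apply: testfun_eqP => x.
transitivity ((cutoff x)%:C * (c * regularize T phi x + regularize V phi x) : R[i]) => //.
by rewrite mulrDr mulrCA.
Qed.

Lemma vanishes_on_linear (c : R[i]) S T (U : set R) :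
  vanishes_on S U -> vanishes_on T U -> vanishes_on (c *: S + T) U.
Proof.
move=> vS vT phi pU; rewrite distr_addE distr_scaleE vS // vT // mulr0.
exact: (addr0 (0 : R[i])).
Qed.

Lemma vanishes_on_ltS T (s t : R) : s <= t ->
  vanishes_on T `]-oo, t[ -> vanishes_on T `]-oo, s[.
Proof.
move=> st; apply: vanishes_on_subset => x; rewrite /= !in_itv /= => xs.
exact: lt_le_trans xs st.
Qed.

Lemma Dplus_linear (c : R[i]) S T : Dplus S -> Dplus T -> Dplus (c *: S + T).
Proof.
move=> /DplusP[e e0 vS] /DplusP[e' e'0 vT]; apply/DplusP.
exists (Num.min e e'); first by rewrite lt_min e0.
apply: vanishes_on_linear.
  by apply: vanishes_on_ltS vS; rewrite ge_min lexx.
by apply: vanishes_on_ltS vT; rewrite ge_min lexx orbT.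
Qed.

Lemma Dplus0 : Dplus (0 : distr R).
Proof. by apply/DplusP; exists 1. Qed.

Lemma Dplus_vanishes T : Dplus T -> vanishes_on T `]-oo, 0[.
Proof. by move=> /DplusP[e e0]; apply: vanishes_on_ltS; exact: ltW. Qed.

Lemma dirac0_vanishes : vanishes_on (dirac0 R) `]-oo, 0[.
Proof.
move=> phi sphi; apply: (@function_supportN _ phi) => /sphi.
by rewrite /= in_itv /= ltxx.
Qed.

Lemma calA_vanishes T : calA T -> vanishes_on T `]-oo, 0[.
Proof.
move=> [c [t [Dt ->]]]; apply: vanishes_on_linear; first exact: dirac0_vanishes.
exact: Dplus_vanishes.
Qed.

(** The first factor rises on [[-2, -1]] and bounds the support on the left; the second falls from 1
    at the origin to 0 at [e / 2]. *)
Lemma bump_subproof (e : R) : 0 < e ->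
  (fun x => (smooth_step (1 * x + 2) * smooth_step (- (2 / e) * x + 1))%:C : R[i]^o)
    \in @test_function R.
Proof.
move=> e0; apply: (@test_functionP _ _ (2 + e)).
- by apply: smooth_mul; apply: smooth_affine; exact: smooth_step_smooth.
- exact: smooth_cst.
move=> x; rewrite ltr_normr => /orP[] h; last by rewrite smooth_step0 ?mul0r //; lra.
have h2 : 2 / e * e <= 2 / e * x by rewrite ler_pM2l ?divr_gt0 //; lra.
by rewrite (@smooth_step0 _ (_ + 1)) ?mulr0 //; move: h2; rewrite divfK ?lt0r_neq0 //; lra.
Qed.

Definition bump (e : R) (e0 : 0 < e) : testfun R := TestFun (bump_subproof e0).

Lemma bump0 (e : R) (e0 : 0 < e) : bump e0 0 = 1.
Proof. by rewrite /= !mulr0 !add0r !smooth_step1 ?mul1r //; lra. Qed.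

Lemma bump_out (e : R) (e0 : 0 < e) x : e / 2 < x -> bump e0 x = 0.
Proof.
move=> h; have h2 : 2 / e * (e / 2) <= 2 / e * x by rewrite ler_pM2l ?divr_gt0 // ltW.
have E : 2 / e * (e / 2) = 1 by field; rewrite lt0r_neq0.
by rewrite /= (@smooth_step0 _ (_ + 1)) ?mulr0 //; lra.
Qed.

(** The bump detects [c] at the origin but lies where a distribution with gap [e] vanishes. Hence
    the sum of C delta_0 and D'_+ is direct. *)
Lemma Dplus_dirac0 (c : R[i]) : Dplus (c *: dirac0 R) -> c = 0.
Proof.
move=> /DplusP[e e0 vc].
rewrite -[LHS]mulr1 -(bump0 e0).
have h : (c *: dirac0 R) (bump e0) = 0; last exact: h.
by apply: (vanishes_on0 vc (_ : e / 2 < e)); [lra|exact: bump_out].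
Qed.

Lemma Dplus_dirac0_inj (c d : R[i]) S T : Dplus S -> Dplus T ->
  c *: dirac0 R + S = d *: dirac0 R + T -> c = d.
Proof.
move=> DS DT E; apply/eqP; rewrite -subr_eq0; apply/eqP; apply: Dplus_dirac0.
have -> : (c - d) *: dirac0 R = (-1) *: S + T; last exact: Dplus_linear.
rewrite scalerBl -(addrK S (c *: dirac0 R)) E -[_ + T - S]addrA.
by rewrite [d *: _ + _]addrC addrK addrC scaleN1r.
Qed.

Definition calA_pred : pred (distr R) := [pred u | `[< calA u >]].

Lemma calA_submod_closed : submod_closed calA_pred.
Proof.
split=> [|a u v /asboolP[c [s [Ds ->]]] /asboolP[d [t [Dt ->]]]]; apply/asboolP.
  by exists 0, 0; split; [exact: Dplus0|rewrite scale0r addr0].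
exists (a * c + d), (a *: s + t); split; first exact: Dplus_linear.
by rewrite scalerDr scalerA scalerDl addrACA.
Qed.

HB.instance Definition _ := GRing.isSubmodClosed.Build _ _ calA_pred calA_submod_closed.

Record calA_elt := CalAElt {
  calA_val :> distr R;
  calA_valP : calA_val \in calA_pred }.

HB.instance Definition _ := [isSub for calA_val].
HB.instance Definition _ := [Choice of calA_elt by <:].
HB.instance Definition _ := [SubChoice_isSubLmodule of calA_elt by <:].

Implicit Types a b c : calA_elt.

Lemma calA_eltP a : calA (calA_val a).
Proof. by case: a => u /= /asboolP. Qed.

Lemma calA_elt_vanishes a : vanishes_on (calA_val a) `]-oo, 0[.
Proof. exact/calA_vanishes/calA_eltP. Qed.

Lemma dirac0_calA : dirac0 R \in calA_pred.
Proof.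
by apply/asboolP; exists 1, 0; rewrite scale1r addr0; split => //; exact: Dplus0.
Qed.

Definition calA_one : calA_elt := CalAElt dirac0_calA.

Lemma vanishes_on_convolution0 S T (vT : vanishes_on T `]-oo, 0[) (s : R) : 0 <= s ->
  vanishes_on S `]-oo, s[ -> vanishes_on (convolution S vT) `]-oo, s[.
Proof.
move=> s0 vS; rewrite -[s]addr0; apply: (vanishes_on_convolution _ vS vT).
by apply: convolutionP; exact: vanishes_on_ltS vS.
Qed.

Lemma convolution_calA a b : convolution a (@calA_elt_vanishes b) \in calA_pred.
Proof.
have [c [s [Ds Ea]]] := calA_eltP a; have [d [t [Dt Eb]]] := calA_eltP b.
have [e e0 vs] := (DplusP _).1 Ds.
(* Expanding the left factor gives [c] times [b] plus [s] convolved with [b]; the latter keeps the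
   gap [e] of [s]. *)
apply/asboolP; exists (c * d), (c *: t + convolution s (@calA_elt_vanishes b)); split.
  apply: Dplus_linear => //; apply/DplusP; exists e => //.
  by apply: vanishes_on_convolution0 => //; exact: ltW.
by rewrite {1}Ea convolution_linearl convolution_dirac0l {1}Eb scalerDr scalerA addrA.
Qed.

Definition calA_mul a b : calA_elt := CalAElt (convolution_calA a b).

Lemma calA_mulA : associative calA_mul.
Proof.
by move=> a b c; apply: val_inj; apply: convolutionA; exact: calA_elt_vanishes.
Qed.

Lemma calA_mul1l : left_id calA_one calA_mul.
Proof. by move=> a; apply: val_inj; exact: convolution_dirac0l. Qed.

Lemma calA_mulr1 : right_id calA_one calA_mul.
Proof.
by move=> a; apply: val_inj; apply: convolution_dirac0r; exact: calA_elt_vanishes.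
Qed.

Lemma calA_mul_linearl (k : R[i]) a b c :
  calA_mul (k *: a + b) c = k *: calA_mul a c + calA_mul b c.
Proof. by apply: val_inj; exact: convolution_linearl. Qed.

Lemma calA_mul_linearr (k : R[i]) a b c :
  calA_mul a (k *: b + c) = k *: calA_mul a b + calA_mul a c.
Proof. by apply: val_inj; exact: convolution_linearr. Qed.

Lemma calA_mulDl : left_distributive calA_mul +%R.
Proof. by move=> a b c; have := calA_mul_linearl 1 a b c; rewrite !scale1r. Qed.

Lemma calA_mulDr : right_distributive calA_mul +%R.
Proof. by move=> a b c; have := calA_mul_linearr 1 a b c; rewrite !scale1r. Qed.

Lemma calA_one_neq0 : calA_one != 0.
Proof.
apply/eqP => /(congr1 calA_val) /= E; have := oner_neq0 R[i]; apply/negP/negPn/eqP.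
by apply: Dplus_dirac0; rewrite scale1r E; exact: Dplus0.
Qed.

HB.instance Definition _ := GRing.Zmodule_isNzRing.Build calA_elt
  calA_mulA calA_mul1l calA_mulr1 calA_mulDl calA_mulDr calA_one_neq0.

Lemma calA_scalerAl (k : R[i]) a b : k *: (a * b) = (k *: a) * b.
Proof.
have := calA_mul_linearl k a 0 b; rewrite addr0 => E; apply/esym/(etrans E).
by rewrite [calA_mul 0 b](mul0r b) addr0.
Qed.

Lemma calA_scalerAr (k : R[i]) a b : k *: (a * b) = a * (k *: b).
Proof.
have := calA_mul_linearr k a b 0; rewrite addr0 => E; apply/esym/(etrans E).
by rewrite [calA_mul a 0](mulr0 a) addr0.
Qed.

HB.instance Definition _ := GRing.Lmodule_isLalgebra.Build R[i] calA_elt calA_scalerAl.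
HB.instance Definition _ := GRing.Lalgebra_isAlgebra.Build R[i] calA_elt calA_scalerAr.

Lemma calA_val_linear : linear calA_val.
Proof. by []. Qed.

HB.instance Definition _ :=
  GRing.isLinear.Build R[i] calA_elt (distr R) _ calA_val calA_val_linear.

Lemma calA_val_range : range calA_val = @calA R.
Proof.
apply/seteqP; split=> [_ [a _ <-]|u Au]; first exact: calA_eltP.
have Au' : u \in calA_pred by apply/asboolP.
by exists (CalAElt Au').
Qed.

Lemma calA_val_convolution a b : is_convolution (calA_val a) (calA_val b) (calA_val (a * b)).
Proof. by apply: convolutionP; exact: calA_elt_vanishes. Qed.

Definition calA_convolution_algebra : calA_algebra R :=
  @CalAAlgebra R calA_elt calA_val val_inj calA_val_range erefl calA_val_convolution.

End ConvolutionAlgebra.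

(** * Units and the canonical character *)

Section CanonicalCharacter.
Variables (R : realType) (A : calA_algebra R).
Implicit Types (a b x y : A) (phi psi : testfun R) (c : R[i]).

Local Notation d := (to_distr A).

Lemma to_distr_calA a : calA (d a).
Proof. by rewrite -(range_to_distr A); exists a. Qed.

(** The coefficient is picked by choice; [Dplus_dirac0_inj] makes it independent of the
    decomposition. *)
Definition calA_pi a : R[i] := projT1 (cid (to_distr_calA a)).

Lemma calA_piP a : exists2 t, Dplus t & d a = calA_pi a *: dirac0 R + t.
Proof. by rewrite /calA_pi; case: cid => c /= [t [Dt E]]; exists t. Qed.

Lemma calA_pi_eq a c t : Dplus t -> d a = c *: dirac0 R + t -> calA_pi a = c.
Proof. by have [s Ds ->] := calA_piP a; exact: Dplus_dirac0_inj. Qed.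

Lemma calA_pi_eq0 a : calA_pi a = 0 <-> Dplus (d a).
Proof.
split=> [a0|Da]; first by have [t Dt ->] := calA_piP a; rewrite a0 scale0r add0r.
by apply: (calA_pi_eq Da); rewrite scale0r add0r.
Qed.

Lemma calA_pi_linear : linear_for *%R calA_pi.
Proof.
move=> c a b; have [s Ds Ea] := calA_piP a; have [t Dt Eb] := calA_piP b.
apply: (calA_pi_eq (Dplus_linear Ds Dt)).
by rewrite linearP Ea Eb scalerDr scalerA scalerDl addrACA.
Qed.

HB.instance Definition _ := GRing.isLinear.Build R[i] A R[i] *%R calA_pi calA_pi_linear.

Lemma to_distr_vanishes a : vanishes_on (d a) `]-oo, 0[.
Proof. exact/calA_vanishes/to_distr_calA. Qed.

Lemma to_distr_vanishesM a b (s t : R) : vanishes_on (d a) `]-oo, s[ ->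
  vanishes_on (d b) `]-oo, t[ -> vanishes_on (d (a * b)) `]-oo, s + t[.
Proof. exact: vanishes_on_convolution (to_distrM a b). Qed.

Lemma calA_pi1 : calA_pi 1 = 1.
Proof. by apply: (calA_pi_eq (@Dplus0 R)); rewrite to_distr1 scale1r addr0. Qed.

Lemma calA_pi_split a : exists2 a0, calA_pi a0 = 0 & a = calA_pi a *: 1 + a0.
Proof.
exists (a - calA_pi a *: 1); last by rewrite addrC subrK.
by rewrite linearB linearZ /= calA_pi1 mulr1 subrr.
Qed.

(** Thresholds of vanishing add up: [e] for [a] and 0 for [b]. *)
Lemma calA_pi_ideal a b : calA_pi a = 0 -> calA_pi (a * b) = 0.
Proof.
move=> /calA_pi_eq0/DplusP[e e0 va]; apply/calA_pi_eq0/DplusP; exists e => //.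
by rewrite -[e]addr0; apply: to_distr_vanishesM => //; exact: to_distr_vanishes.
Qed.

Lemma calA_pi_monoid_morphism : monoid_morphism calA_pi.
Proof.
split=> [|a b]; first exact: calA_pi1.
(* Splitting the left factor leaves [a0 * b], which lies in the kernel by [calA_pi_ideal]. *)
have [a0 pa0 ->] := calA_pi_split a.
rewrite mulrDl -scalerAl mul1r !linearD !linearZ /= pa0 calA_pi_ideal // calA_pi1.
by rewrite !addr0 mulr1.
Qed.

HB.instance Definition _ :=
  GRing.isMonoidMorphism.Build A R[i] calA_pi calA_pi_monoid_morphism.

(** * The Neumann series of an element of D'_+ *)

Section Neumann.
Variables (x : A) (e : R).
Hypotheses (e0 : 0 < e) (vx : vanishes_on (d x) `]-oo, e[).

Lemma to_distr_vanishesX n : vanishes_on (d (x ^+ n)) `]-oo, n%:R * e[.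
Proof.
elim: n => [|n IH]; first by rewrite mul0r; exact: to_distr_vanishes.
rewrite exprS -natr1 mulrDl mul1r addrC; exact: to_distr_vanishesM.
Qed.

Definition neumann_sum n : A := \sum_(i < n) x ^+ i.

Lemma neumann_sum_stable phi n m : (n <= m)%N ->
  function_support phi `<=` `]-oo, n%:R * e[ -> d (neumann_sum m) phi = d (neumann_sum n) phi.
Proof.
move=> /subnK <- sphi; elim: (m - n)%N => // k IH.
rewrite addSn /neumann_sum big_ord_recr /= linearD distr_addE IH.
rewrite (_ : d (x ^+ (k + n)) phi = 0) ?addr0 //.
apply: to_distr_vanishesX; apply: (subset_trans sphi) => y; rewrite /= !in_itv /=.
by move=> /lt_le_trans; apply; rewrite ler_pM2r // ler_nat leq_addl.
Qed.

Lemma exists_support_lt (K : set R) : compact K ->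
  exists n : nat, K `<=` `]-oo, n%:R * e[.
Proof.
move=> /compact_bound[B B0 hB]; exists (Num.truncn (B / e)).+1 => y /hB yB.
rewrite /= in_itv /= -ltr_pdivrMr //; apply: le_lt_trans (truncnS_gt _).
by rewrite ler_pM2r ?invr_gt0 //; apply: le_trans (ler_norm _) yB.
Qed.

Definition neumann_order phi : nat :=
  projT1 (cid (exists_support_lt (@testfun_compact R phi))).

(* The sum of all x ^+ i, which is locally finite: x ^+ i vanishes on ]-oo, i * e[. *)
Definition neumann_fun : testfun R -> R[i]^o :=
  fun phi => d (neumann_sum (neumann_order phi)) phi.

(** Any sufficiently large [n] gives the same value, so several test functions, or all those
    supported in one compact set, can share one partial sum; linearity and continuity of the series
    follow. *)
Lemma neumann_funE phi n : function_support phi `<=` `]-oo, n%:R * e[ ->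
  neumann_fun phi = d (neumann_sum n) phi.
Proof.
move=> sn; rewrite /neumann_fun /neumann_order; case: cid => m /= sm.
by have [nm|/ltnW mn] := leqP n m; [|apply: esym]; exact: neumann_sum_stable.
Qed.

Lemma neumann_subproof : neumann_fun \in @distribution_pred R.
Proof.
apply/asboolP; split=> [c phi psi|K cK].
  have cU := compactU (@testfun_compact R (c *: phi + psi))
    (compactU (@testfun_compact R phi) (@testfun_compact R psi)).
  have [n hn] := exists_support_lt cU.
  rewrite !(@neumann_funE _ n); first exact: distr_linear_subproof.
  - by move=> y sy; apply: hn; right; right.
  - by move=> y sy; apply: hn; right; left.
  - by move=> y sy; apply: hn; left.
have [n hn] := exists_support_lt cK.
have [M [m hM]] := distr_continuous (d (neumann_sum n)) cK.
exists M, m => phi pK; rewrite (@neumann_funE _ n); first exact: hM.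
exact: subset_trans pK hn.
Qed.

Definition neumann : distr R := Distr neumann_subproof.

Lemma neumann_sub_dirac0 : Dplus (neumann - dirac0 R).
Proof.
apply/DplusP; exists e => // phi sphi.
have -> : (neumann - dirac0 R) phi = neumann_fun phi - dirac0 R phi by [].
(* On []-oo, e[] the partial sum of length 1, the unity, already is the whole series. *)
rewrite (@neumann_funE _ 1%N); last by rewrite mul1r.
by rewrite /neumann_sum big_ord1 expr0 to_distr1 subrr.
Qed.

(* With y the Neumann series and S n its partial sum,
   (1 - x) y - 1 = (1 - x) (y - S n) - x^n vanishes on ]-oo, n e[ for every n. *)
Lemma neumann_right_inverse : exists2 b, calA_pi b = 0 & (1 - x) * (1 + b) = 1.
Proof.
(* The series is so far a mere distribution; membership in [calA] lifts it to an element of [A]. *)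
have [y _ yE] : range d neumann.
  rewrite (range_to_distr A); exists 1, (neumann - dirac0 R).
  by split; [exact: neumann_sub_dirac0|rewrite scale1r addrC subrK].
exists (y - 1).
  by apply/calA_pi_eq0; rewrite linearB /= to_distr1 yE; exact: neumann_sub_dirac0.
rewrite (_ : 1 + (y - 1) = y); last by rewrite addrC subrK.
apply/eqP; rewrite -subr_eq0; apply/eqP.
apply: (@to_distr_inj _ A); rewrite linear0; apply: distr_eqP => phi.
have [n sphi] := exists_support_lt (@testfun_compact R phi).
have -> : (1 - x) * y - 1 = (-1) *: x ^+ n + (1 - x) * (y - neumann_sum n).
  have geo : (1 - x) * neumann_sum n = 1 - x ^+ n.
    by rewrite -[1 - x]opprB mulNr -subrX1 opprB.
  by rewrite scaleN1r mulrBr geo opprB addrCA addKr.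
rewrite linearP; apply: (@vanishes_on_linear R _ _ _ _ _ _ phi sphi).
  exact: to_distr_vanishesX.
rewrite -[_ * e]add0r; apply: to_distr_vanishesM; first exact: to_distr_vanishes.
move=> psi spsi.
have -> : d (y - neumann_sum n) = neumann - d (neumann_sum n) by rewrite linearB /= yE.
transitivity (neumann_fun psi - d (neumann_sum n) psi) => //.
by rewrite (neumann_funE spsi) subrr.
Qed.

End Neumann.

Lemma right_inverse_1D a : calA_pi a = 0 ->
  exists2 b, calA_pi b = 0 & (1 + a) * (1 + b) = 1.
Proof.
move=> a0; rewrite -[a]opprK.
have /calA_pi_eq0/DplusP[e e0 vx] : calA_pi (- a) = 0 by rewrite linearN /= a0 oppr0.
exact: neumann_right_inverse e0 vx.
Qed.

(* The right inverse of 1 + a has again the form 1 + b, hence is itself right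
   invertible. *)
Lemma is_unit_1D a : calA_pi a = 0 -> is_unit (1 + a).
Proof.
move=> /right_inverse_1D[b b0 ab]; exists (1 + b); split => //.
have [c _ bc] := right_inverse_1D b0.
suff -> : 1 + a = 1 + c by [].
by transitivity ((1 + a) * ((1 + b) * (1 + c))); [rewrite bc mulr1|rewrite mulrA ab mul1r].
Qed.

Lemma nonvanishing_functional_pi (L : {scalar A}) :
  normalized_nonvanishing_on_units L -> forall a, L a = calA_pi a.
Proof.
move=> [Lu L1] a; have [a0 pa0 {1}->] := calA_pi_split a.
have La0 : L a0 = 0.
  apply/eqP/negPn/negP => l0.
  have /Lu/eqP : is_unit (1 + (- (L a0)^-1) *: a0).
    by apply: is_unit_1D; rewrite linearZ /= pa0 mulr0.
  by apply; rewrite linearD linearZ /= L1 mulNr mulVf // subrr.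
by rewrite linearD linearZ /= L1 La0 addr0 mulr1.
Qed.

Lemma calA_pi_nonvanishing : normalized_nonvanishing_on_units calA_pi.
Proof.
split=> [u [v [uv _]]|]; last exact: calA_pi1.
apply/eqP => u0; have := rmorphM calA_pi u v; rewrite uv rmorph1 /= u0 mul0r.
by apply/eqP; exact: oner_neq0.
Qed.

End CanonicalCharacter.

Theorem proposition4p2 (R : realType) :
  inhabited (calA_algebra R) /\
  forall A : calA_algebra R,
    (exists pi : {lrmorphism A -> R[i] | *%R},
      [/\ forall (a : A) (c : R[i]) (t : distr R),
            Dplus t -> to_distr A a = c *: dirac0 R + t -> pi a = c,
          forall a : A, pi a = 0 <-> Dplus (to_distr A a),
          normalized_nonvanishing_on_units pi
        & forall L : {scalar A}, normalized_nonvanishing_on_units L ->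
            forall a : A, L a = pi a]) /\
    GKZ_algebra A.
Proof.
split=> [|A]; first exact/inhabits/calA_convolution_algebra.
split; last first.
  move=> L /nonvanishing_functional_pi LE a b.
  by rewrite !LE; exact: (rmorphM (@calA_pi R A)).
exists (@calA_pi R A); split.
- exact: calA_pi_eq.
- exact: calA_pi_eq0.
- exact: calA_pi_nonvanishing.
- exact: nonvanishing_functional_pi.
Qed.
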